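(* Let $n\ge 1$ and let $V, W, Z$ be complex vector spaces of dimension $3n$. Let $G = \mathrm{SL}(V)\times \mathrm{SL}(W)\times \mathrm{SL}(Z)$ act on $(V\otimes W\otimes Z)^{\oplus 9}$ by acting on each copy of $V\otimes W\otimes Z$ via $(g_1,g_2,g_3)\cdot (v\otimes w\otimes z) = g_1v\otimes g_2 w\otimes g_3 z$. Then $$\beta_G\big((V\otimes W\otimes Z)^{\oplus 9}\big) \ge \sigma_G\big((V\otimes W\otimes Z)^{\oplus 9}\big) \ge 4^n-1.$$
   Context: The ground field is $\mathbb{C}$. For a rational representation $U$ of a reductive group $G$, $\mathbb{C}[U]^G=\bigoplus_{d\ge 0}\mathbb{C}[U]^G_d$ is the graded ring of polynomial invariants, and $\beta_G(U)$ is the smallest integer $D\ge 0$ such that the homogeneous invariants of degree $\le D$ generate $\mathbb{C}[U]^G$ as a $\mathbb{C}$-algebra. The null cone $\mathcal{N}\subseteq U$ is the common zero set of all homogeneous invariants of positive degree; $\sigma_G(U)$ is the smallest integer $D\ge 0$ such that $\mathcal{N}$ equals the common zero set of the homogeneous invariants of degrees $1,\dots,D$. *)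

(* Defs.v *)
From mathcomp Require Import all_boot all_order all_algebra.
(* [mpoly] must be imported before the MathComp-Analysis files: in the other
   order their notations clash. *)
From mathcomp Require Import complex mpoly.
From mathcomp Require Import boolp constructive_ereal reals.
From mathcomp Require Import ring.

Set Implicit Arguments.
Unset Strict Implicit.
Unset Printing Implicit Defensive.

Import Order.TTheory GRing.Theory Num.Theory.
Local Open Scope ring_scope.

(* The minimum of a set of natural numbers, and +oo if the set is empty.
   (For the sets defining beta and sigma below, non-emptiness is Hilbert's
   finiteness theorem, resp. basis theorem.) *)
Definition least (P : nat -> Prop) : \bar int :=
  if pselect (exists D : nat, `[< P D >]) is left exP
  then ((ex_minn exP)%:Z)%:E else +oo%E.

Lemma leastP (P : nat -> Prop) (D : nat) :
  least P = (D%:Z)%:E <-> P D /\ forall D', P D' -> (D <= D')%N.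
Proof.
rewrite /least; case: pselect => [exP|nP]; last first.
  by split=> // -[PD _]; case: nP; exists D; apply/asboolP.
case: ex_minnP => m /asboolP Pm min_m; split=> [[<-]|[PD minD]].
  by split=> // D' PD'; apply/min_m/asboolP.
congr (_%:Z)%:E; apply/eqP; rewrite eqn_leq minD // andbT.
by apply/min_m/asboolP.
Qed.

Section Invariants.

(* A family [act g] of linear transformations of the coordinate space
   U = F^I, over an algebraically closed field F of characteristic 0. *)
Variables (F : numClosedFieldType) (I : finType) (G : Type).
Variable act : G -> {ffun I -> F} -> {ffun I -> F}.

(* F[U] is {mpoly F[#|I|]}: the coordinate i : I is 'X_(enum_rank i). *)
Definition pvalue (p : {mpoly F[#|I|]}) (u : {ffun I -> F}) : F :=
  p.@[fun k => u (enum_val k)].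

Definition invariant (p : {mpoly F[#|I|]}) : Prop :=
  forall (g : G) (u : {ffun I -> F}), pvalue p (act g u) = pvalue p u.

(* A subalgebra is generated by S when each of its elements is a polynomial
   expression q(h_1, ..., h_k) in finitely many elements of S. *)
Definition generated_in_degree_le (D : nat) : Prop :=
  forall f : {mpoly F[#|I|]}, invariant f ->
  exists (k : nat) (h : k.-tuple {mpoly F[#|I|]}) (q : {mpoly F[k]}),
    (forall j : 'I_k, invariant (tnth h j) /\
       exists2 d : nat, (d <= D)%N & tnth h j \is d.-homog) /\
    f = q \mPo h.

Definition beta : \bar int := least generated_in_degree_le.

Definition in_nullcone (u : {ffun I -> F}) : Prop :=
  forall (d : nat) (f : {mpoly F[#|I|]}),
    (0 < d)%N -> f \is d.-homog -> invariant f -> pvalue f u = 0.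

Definition in_nullcone_le (D : nat) (u : {ffun I -> F}) : Prop :=
  forall (d : nat) (f : {mpoly F[#|I|]}),
    (0 < d <= D)%N -> f \is d.-homog -> invariant f -> pvalue f u = 0.

Definition sigma : \bar int :=
  least (fun D => forall u, in_nullcone u <-> in_nullcone_le D u).

End Invariants.

Definition SL (F : fieldType) (m : nat) : Type := {g : 'M[F]_m | \det g == 1}.

Section Tensors.

Variables (F : fieldType) (r a b c : nat).

(* (V (x) W (x) Z)^(+ r) for V = F^a, W = F^b, Z = F^c: the coordinates are
   indexed by the copy t : 'I_r and by the basis e_i (x) e_j (x) e_k. *)
Definition tensor_index : finType := ('I_r * ('I_a * 'I_b * 'I_c))%type.
Definition tensors : Type := {ffun tensor_index -> F}.

Definition tensor_act (g : SL F a * SL F b * SL F c) (u : tensors) : tensors :=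
  [ffun x : tensor_index =>
     let: (t, (i, j, k)) := x in
     \sum_(i' < a) \sum_(j' < b) \sum_(k' < c)
        val g.1.1 i i' * val g.1.2 j j' * val g.2 k k' * u (t, (i', j', k'))].

Definition pure_tensor (t : 'I_r) (v : 'cV[F]_a) (w : 'cV[F]_b) (z : 'cV[F]_c) :
    tensors :=
  [ffun x : tensor_index =>
     let: (s, (i, j, k)) := x in
     if s == t then v i 0 * w j 0 * z k 0 else 0].

Lemma tensor_act_pure g t v w z :
  tensor_act g (pure_tensor t v w z) =
  pure_tensor t (val g.1.1 *m v) (val g.1.2 *m w) (val g.2 *m z).
Proof.
apply/ffunP => -[s [[i j] k]]; rewrite !ffunE !mxE; case: (s =P t) => st; last first.
  rewrite big1 // => i' _; rewrite big1 // => j' _; rewrite big1 // => k' _.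
  by rewrite ffunE; move/eqP/negPf: st => ->; rewrite mulr0.
rewrite !mulr_suml; apply: eq_bigr => i' _.
rewrite -mulrA mulr_suml mulr_sumr; apply: eq_bigr => j' _.
rewrite !mulr_sumr; apply: eq_bigr => k' _.
by rewrite ffunE st eqxx; ring.
Qed.

Lemma tensor_act_linear g (e : F) (u u' : tensors) x :
  tensor_act g [ffun y => e * u y + u' y] x =
  e * tensor_act g u x + tensor_act g u' x.
Proof.
case: x => t [[i j] k]; rewrite !ffunE mulr_sumr -big_split /=.
apply: eq_bigr => i' _; rewrite mulr_sumr -big_split /=.
apply: eq_bigr => j' _; rewrite mulr_sumr -big_split /=.
by apply: eq_bigr => k' _; rewrite ffunE mulrDr mulrCA.
Qed.

End Tensors.

(* Main.v *)
(** Let y be the 9-tuple [chain_tensor]. An invariant restricted to the span of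
    the basis vectors occurring in y is invariant under the diagonal torus of G,
    hence a combination of monomials in which each of the 3n indices of V, of W
    and of Z is used the same number M of times. For the support of y these
    linear equations say that the sum of the multiplicities at the positions
    (0,2) and (1,0) of a block of three indices drops by a factor 4 from each
    block to the next, so M = 0 or M >= 4^(n-1), and the homogeneous invariants
    of degree 1, ..., 4^n - 2 vanish at y.

    To see that y is not in the null cone, contract Z with the vector
    R^T (1, X, ..., X^(N-1)), R a generic N x N matrix (N = 3n), weight the nine
    copies by powers of X and take the determinant over V (x) W: the
    coefficients of the resulting polynomial in X are SL(V) x SL(W)-invariant
    and SL(Z) acts on them by translating R. At y this polynomial is a product
    over the blocks; by Dedekind's Prague theorem all products of coefficients
    of the factors are integral over the ring generated by the coefficients of
    the product. A suitable product of M = 4^n choices of terms is the M-th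
    power of the product of the columns of R, so det R is integral. Pairing an
    integral equation of degree d with (det R)^d by the SL-invariant apolar
    form, which is positive definite on real polynomials, turns its coefficients
    into invariants of positive degree, which cannot all vanish at y. *)

From HB Require Import structures.
Require Import Defs.
From mathcomp Require Import all_boot all_order all_algebra.
From mathcomp Require Import complex mpoly ssrcomplements.
From mathcomp Require Import boolp constructive_ereal reals.
From mathcomp Require Import ring zify.

Set Implicit Arguments.
Unset Strict Implicit.
Unset Printing Implicit Defensive.

Import Order.TTheory GRing.Theory Num.Theory.
Local Open Scope ring_scope.

(** * Integral closure and Dedekind's Prague theorem *)

Section Integrality.

Lemma coefM_top (A : comNzRingType) (f g : {poly A}) d m :
  (size f <= d.+1)%N -> (size g <= m.+1)%N -> (f * g)`_(d + m) = f`_d * g`_m.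
Proof.
move=> sf sg; rewrite coefM.
have dm : (d < (d + m).+1)%N by rewrite ltnS leq_addr.
rewrite (bigD1 (Ordinal dm)) //= addKn big1 ?addr0 // => i /eqP ni.
have [lid | gid] := ltnP i d.
  by rewrite [g`__]nth_default ?mulr0 // (leq_trans sg) // ltn_subRL ltn_add2r.
rewrite nth_default ?mul0r // (leq_trans sf) // ltn_neqAle gid andbT.
by apply/eqP => di; apply: ni; apply/val_inj.
Qed.

(* Content form of the Dedekind-Mertens lemma,
   c(f)^(m+1) c(g) <= c(f)^m c(fg) with m >= size g, the span being replaced by
   an arbitrary additive subgroup S. *)
Lemma dedekind_mertens (A : comNzRingType) (S : A -> Prop) m d (f g : {poly A}) :
  S 0 -> (forall x y, S x -> S y -> S (x - y)) ->
  (size g <= m)%N -> (size f <= d)%N ->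
  (forall s : seq nat, size s = m ->
     forall l, S (\prod_(i <- s) f`_i * (f * g)`_l)) ->
  forall s : seq nat, size s = m.+1 -> forall j, S (\prod_(i <- s) f`_i * g`_j).
Proof.
(* The outer induction lowers the size of g, the inner one the size of f. *)
move=> S0 SB; elim: m d f g => [|m IHm] d f g sg.
  by move=> _ _ s _ j; rewrite nth_default ?mulr0 // (leq_trans sg).
elim: d f => [|d IHd] f sf fgS s ss j.
  case: s ss => // i s _.
  by rewrite big_cons nth_default ?mul0r // (leq_trans sf).
have topE := coefM_top sf sg.
(* Products with an extra factor f_d. The product f_d g_m is the top coefficient of fg. For k < m
   the outer induction applies to f and f_d g', as f_d f g' differs from f_d fg by f X^m times f_d
   g_m = (fg)_(d+m). *)
have claim1 t k : size t = m.+1 -> S (\prod_(i <- t) f`_i * (f`_d * g`_k)).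
  move=> st; have [ltkm | gtkm | ->] := ltngtP k m; last 1 first.
  - by rewrite -topE; apply: fgS.
  - pose g' := take_poly m g.
    have -> : f`_d * g`_k = (f`_d *: g')`_k by rewrite coefZ coef_take_poly ltkm.
    apply: (IHm d.+1) => //.
      by rewrite (leq_trans (size_scale_leq _ _)) // size_take_poly.
    move=> u su l.
    have gE : g = g' + g`_m *: 'X^m.
      apply/polyP => i; rewrite coefD coef_take_poly coefZ coefXn.
      case: ltngtP => [_|lt|->]; rewrite ?mulr0 ?addr0 ?mulr1 ?add0r //.
      by rewrite nth_default // (leq_trans sg).
    have -> : f * (f`_d *: g') = f`_d *: (f * g) - (f`_d * g`_m) *: (f * 'X^m).
      have -> : f * g = f * g' + g`_m *: (f * 'X^m) by rewrite {1}gE mulrDr scalerAr.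
      by rewrite scalerDr scalerA addrK scalerAr.
    rewrite coefB !coefZ coefMXn mulrBr; apply: SB.
      have := fgS (d :: u) _ l; rewrite big_cons /= su => /(_ erefl).
      by rewrite mulrA [f`_d * _]mulrC.
    case: ltnP => _; first by rewrite !mulr0.
    have := fgS ((l - m)%N :: u) _ (d + m)%N; rewrite big_cons /= su => /(_ erefl).
    by rewrite topE [f`_(l - m) * _]mulrC -mulrA [f`_(l - m) * _]mulrC.
  - by rewrite [g`_k]nth_default ?mulr0 // (leq_trans sg).
(* The remaining products avoid f_d, so f can be truncated to f'; the correction f_d X^d g is
   covered by [claim1]. *)
pose f' := take_poly d f.
have f'E i : i != d -> f'`_i = f`_i.
  rewrite coef_take_poly; case: ltngtP => // lt _.
  by rewrite nth_default // (leq_trans sf).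
have f'd : f'`_d = 0 by rewrite coef_take_poly ltnn.
have prodf' u : d \notin u -> \prod_(i <- u) f'`_i = \prod_(i <- u) f`_i.
  move=> du; apply: eq_big_seq => i iu; apply: f'E.
  by apply: contraNneq du => <-.
have [ds | ds] := boolP (d \in s).
  rewrite (perm_big _ (perm_to_rem ds)) /= big_cons [f`_d * _]mulrC -mulrA.
  by apply: claim1; rewrite size_rem // ss.
rewrite -prodf' //; apply: (IHd f') => //; first by rewrite size_take_poly.
move=> u su l; have [du | du] := boolP (d \in u).
  by rewrite (perm_big _ (perm_to_rem du)) /= big_cons f'd !mul0r.
have -> : f' * g = f * g - f`_d *: ('X^d * g).
  have {1}-> : f = f' + f`_d *: 'X^d.
    apply/polyP => i; rewrite coefD coefZ coefXn.
    by case: (eqVneq i d) => [->|id]; rewrite ?f'd ?mulr1 ?add0r // mulr0 addr0 f'E.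
  by rewrite mulrDl -scalerAl addrK.
rewrite prodf' // coefB coefZ coefXnM mulrBr; apply: SB; first exact: fgS.
by case: ltnP => _; [rewrite !mulr0 | apply: claim1].
Qed.

Variables (B : comNzRingType) (A : idomainType) (phi : {rmorphism B -> A}).

Local Notation int_over := (integralOver phi).
Definition int_coef (p : {poly A}) := forall i, int_over p`_i.

Lemma int_sum (I : Type) (r : seq I) (P : pred I) (E : I -> A) :
  (forall i, P i -> int_over (E i)) -> int_over (\sum_(i <- r | P i) E i).
Proof.
move=> hE; apply: (big_ind int_over) => //; first exact: integral0.
exact: integral_add.
Qed.

Lemma int_coefC c : int_over c -> int_coef c%:P.
Proof. by move=> hc i; rewrite coefC; case: ifP => // _; apply: integral0. Qed.

Lemma int_coefM p q : int_coef p -> int_coef q -> int_coef (p * q).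
Proof. by move=> hp hq i; rewrite coefM; apply: int_sum => j _; apply: integral_mul. Qed.

Lemma int_coef_sum (I : Type) (r : seq I) (P : pred I) (E : I -> {poly A}) :
  (forall i, P i -> int_coef (E i)) -> int_coef (\sum_(i <- r | P i) E i).
Proof. by move=> hE j; rewrite coef_sum; apply: int_sum => i /hE. Qed.

Lemma int_coef_prod (I : Type) (r : seq I) (P : pred I) (E : I -> {poly A}) :
  (forall i, P i -> int_coef (E i)) -> int_coef (\prod_(i <- r | P i) E i).
Proof.
move=> hE; apply: (big_ind int_coef) => //; last exact: int_coefM.
by rewrite -polyC1; apply/int_coefC/integral1.
Qed.

Lemma int_signr (b : bool) : int_over ((-1) ^+ b).
Proof. by case: b; rewrite ?expr1 ?expr0; [apply: integral_opp|]; apply: integral1. Qed.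

Lemma int_char_poly k (M : 'M[A]_k) :
  (forall i j, int_over (M i j)) -> int_coef (char_poly M).
Proof.
move=> hM; apply: int_coef_sum => s _; apply: int_coefM.
  by rewrite -[-1]/(- 1%:P) -polyCN -polyC_exp; apply/int_coefC/int_signr.
apply: int_coef_prod => i _ l; rewrite !mxE coefB coefMn coefX coefC.
apply: integral_sub.
  by case: (i == _); rewrite ?mulr1n ?mulr0n; [apply: integral_nat | apply: integral0].
by case: ifP => _ //; apply: integral0.
Qed.

(* Cayley-Hamilton: z is an eigenvalue of a matrix with integral entries. *)
Lemma int_eigen (T : finType) (w : T -> A) (z : A) (t0 : T) :
  w t0 != 0 ->
  (forall t, exists2 c : T -> A, (forall t', int_over (c t')) &
     z * w t = \sum_t' c t' * w t') ->
  int_over z.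
Proof.
move=> wt0 /fin_all_exists2 [c hc hz].
pose M : 'M[A]_#|T| := \matrix_(i, j) c (enum_val i) (enum_val j).
pose v : 'cV[A]_#|T| := \col_i w (enum_val i).
have Mv : M *m v = z *: v.
  apply/matrixP => i j; rewrite !mxE hz (reindex _ (onW_bij _ (enum_val_bij T))) /=.
  by apply: eq_bigr => k _; rewrite !mxE.
apply: (@integral_root_monic _ _ phi z (char_poly M)); first exact: char_poly_monic.
  rewrite -[root _ _]/(_ == 0).
  have -> : (char_poly M).[z] = \det (z%:M - M).
    rewrite /char_poly -horner_evalE -det_map_mx; congr (\det _).
    by apply/matrixP => k l; rewrite !mxE /= ?horner_evalE hornerD hornerN hornerC hornerMn hornerX.
  have : \adj (z%:M - M) *m ((z%:M - M) *m v) = 0.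
    by rewrite mulmxBl Mv mul_scalar_mx subrr mulmx0.
  rewrite mulmxA mul_adj_mx mul_scalar_mx => /matrixP/(_ (enum_rank t0) 0).
  by rewrite !mxE enum_rankK => /eqP; rewrite mulf_eq0 (negPf wt0) orbF.
apply: (integral_poly phi _).1; apply: int_char_poly => i j; rewrite mxE; exact: hc.
Qed.

(* Dedekind's Prague theorem *)
Lemma int_coefM_coef f g : int_coef (f * g) -> forall i j, int_over (f`_i * g`_j).
Proof.
move=> fg i j; have [-> | f0] := eqVneq f 0.
  by rewrite coef0 mul0r; apply: integral0.
pose m := size g; pose T := {ffun 'I_m -> 'I_(size f)}.
pose w (t : T) := \prod_k f`_(t k).
(* Products of [size g] coefficients of f span a module over the integral elements which
   multiplication by f_i g_j preserves, by [dedekind_mertens]. A power of the leading coefficient of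
   f is the nonzero entry wanted by [int_eigen]. *)
pose S x := exists2 c : T -> A, (forall t, int_over (c t)) & x = \sum_t c t * w t.
have S0 : S 0.
  exists (fun=> 0); first by move=> _; apply: integral0.
  by rewrite big1 // => t _; rewrite mul0r.
have SB x y : S x -> S y -> S (x - y).
  case=> c hc -> [c' hc' ->]; exists (fun t => c t - c' t).
    by move=> t; apply: integral_sub.
  by rewrite -sumrB; apply: eq_bigr => t _; rewrite mulrBl.
have ltsf : ((size f).-1 < size f)%N by rewrite prednK // size_poly_gt0.
pose t0 : T := [ffun=> Ordinal ltsf].
apply: (@int_eigen T w _ t0) => [|t].
  by apply/prodf_neq0 => k _; rewrite ffunE /= -/(lead_coef f) lead_coef_eq0.
suff : S (f`_i * g`_j * w t) by [].
have -> : f`_i * g`_j * w t =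
    \prod_(k <- i :: [seq val (t k) | k <- enum 'I_m]) f`_k * g`_j.
  by rewrite big_cons big_map big_enum mulrAC.
apply: (dedekind_mertens S0 SB (leqnn _) (leqnn _)); last first.
  by rewrite /= size_map size_enum_ord.
move=> s ss l.
have [/all_nthP sf | /allPn[k ks]] := boolP (all (fun k => k < size f)%N s); last first.
  rewrite -leqNgt => /(nth_default 0) fk.
  by rewrite (perm_big _ (perm_to_rem ks)) /= big_cons fk !mul0r.
have lt (k : 'I_m) : (nth 0%N s k < size f)%N by apply: sf; rewrite ss.
pose t1 : T := [ffun k => Ordinal (lt k)].
exists (fun t' => if t' == t1 then (f * g)`_l else 0).
  by move=> t'; case: ifP => _ //; apply: integral0.
rewrite (bigD1 t1) //= eqxx [X in _ + X]big1 ?addr0; last first.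
  by move=> t' nt; rewrite (negPf nt) mul0r.
rewrite mulrC; congr (_ * _); rewrite (big_nth 0%N) ss big_mkord.
by apply: eq_bigr => k _; rewrite ffunE.
Qed.

(** The factor e absorbs signs and, as 0, the vanishing coefficients of p'. *)
Definition sub_coef (p' p : {poly A}) :=
  forall j, exists2 e, int_over e & exists k, p'`_j = e * p`_k.

(** By Dedekind's theorem all products of a coefficient of p and one of q are integral, and the
    coefficients of p'q are integral combinations of these. *)
Lemma int_coef_replace p p' q : sub_coef p' p -> int_coef (p * q) -> int_coef (p' * q).
Proof.
move=> pp' pq i; rewrite coefM; apply: int_sum => j _.
have [e he [k ->]] := pp' j; rewrite -mulrA; apply: integral_mul => //.
exact: int_coefM_coef.
Qed.

Lemma int_coef_replace_prod (I : Type) (r : seq I) (p p' : I -> {poly A}) q :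
  (forall i, sub_coef (p' i) (p i)) ->
  int_coef (\prod_(i <- r) p i * q) -> int_coef (\prod_(i <- r) p' i * q).
Proof.
move=> pp'; elim: r q => [|i r IHr] q; first by rewrite !big_nil.
rewrite !big_cons -!mulrA => /(int_coef_replace (pp' i)).
by rewrite mulrCA [X in _ -> int_coef X]mulrCA => /IHr.
Qed.

(** Replacing all M copies of each factor by the constant polynomial of its chosen coefficient
    leaves z^M, z being the product of these coefficients; and z is a root of X^M - z^M. *)
Lemma int_prodX_coef (I : Type) (r : seq I) (p : I -> {poly A}) M (j : I -> nat) :
  (0 < M)%N -> int_coef (\prod_(i <- r) p i ^+ M) ->
  int_over (\prod_(i <- r) (p i)`_(j i)).
Proof.
rewrite prodrXl => M0 hp.
have pp' i : sub_coef ((p i)`_(j i))%:P (p i).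
  move=> k; rewrite coefC; case: eqP => _.
    by exists 1; [apply: integral1 | exists (j i); rewrite mul1r].
  by exists 0; [apply: integral0 | exists 0%N; rewrite mul0r].
have {hp} : int_coef (\prod_(i <- r) p i ^+ M * 1) by rewrite mulr1 prodrXl.
pose P := \prod_(i <- r) p i; pose Q := \prod_(i <- r) ((p i)`_(j i))%:P.
have repl a q : int_coef (P ^+ a * q) -> int_coef (Q ^+ a * q).
  elim: a q => [|a IHa] q; first by rewrite !expr0.
  rewrite !exprS -!mulrA => /(int_coef_replace_prod pp').
  by rewrite mulrCA [X in _ -> int_coef X]mulrCA => /IHa.
rewrite prodrXl => /repl; rewrite mulr1 /Q -rmorph_prod -rmorphXn => /(_ 0%N).
rewrite coefC /=; set z := \prod_(i <- r) _ => hz.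
apply: (@integral_root_monic _ _ phi z ('X^M - (z ^+ M)%:P)).
- exact: monicXnsubC.
- by rewrite /root hornerD hornerN hornerC hornerXn subrr eqxx.
apply: (integral_poly phi _).1 => k; rewrite coefB coefXn coefC.
apply: integral_sub; first exact: integral_nat.
by case: ifP => // _; apply: integral0.
Qed.

End Integrality.

(** * Polynomial functions and the apolar pairing *)

Section PolynomialFunctions.

(** Induction by one variable at a time suits the chain rule and the trade of a variable for a
    derivative in the apolar pairing. *)
Lemma mpoly_indX (n : nat) (R : comNzRingType) (P : {mpoly R[n]} -> Prop) :
  P 1 -> (forall c p q, P p -> P q -> P (c *: p + q)) ->
  (forall i p, P p -> P ('X_i * p)) -> forall p, P p.
Proof.
move=> P1 PD PX.
have PXm d m : mdeg m = d -> P 'X_[m].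
  elim: d m => [|d IHd] m md.
    by move/eqP: md; rewrite mdeg_eq0 => /eqP ->; rewrite mpolyX0.
  have [i mi] : exists i, m i != 0%N.
    apply/existsP; apply: contra_eqT md => /existsPn m0.
    by rewrite mdegE big1 // => i _; apply/eqP; rewrite -[_ == _]negbK.
  have mE : m = (U_(i) + (m - U_(i)))%MM.
    by rewrite addmC submK // lep1mP.
  rewrite mE mpolyXD; apply/PX/IHd; move: md.
  by rewrite mE mdegD mdeg1 add1n addmC addmK => -[].
apply: mpolyind => [|c m p _ _]; first by have := PD (-1) _ _ P1 P1; rewrite scaleN1r addNr.
by apply: PD; apply: (PXm (mdeg m)).
Qed.

Lemma poly_eval0 (F : numFieldType) (p : {poly F}) : (forall x, p.[x] = 0) -> p = 0.
Proof.
move=> p0; apply: (@roots_geq_poly_eq0 _ p [seq i%:R | i <- iota 0 (size p)]).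
- by apply/allP => x _; rewrite /root p0.
- by rewrite map_inj_uniq ?iota_uniq //; apply: mulrIn; rewrite oner_eq0.
- by rewrite size_map size_iota.
Qed.

Lemma mcoeff_muni (R : nzRingType) n (p : {mpoly R[n.+1]}) (m : 'X_{1..n.+1}) :
  ((muni p)`_(m ord_max))@_[multinom m (widen_ord (leqnSn n) i) | i < n] = p@_m.
Proof.
rewrite muniE coef_sum raddf_sum /= [in RHS](mpolyE p) raddf_sum /=.
apply: eq_bigr => k _; rewrite !coefZ coefXn mcoeffZ mcoeffX.
set a := [multinom _ | _ < _]; set b := [multinom _ | _ < _].
have -> : (k == m) = (a == b) && (m ord_max == k ord_max).
  apply/eqP/andP => [km | [/eqP ab /eqP e]]; first by rewrite /a /b km !eqxx.
  apply/mnmP => i.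
  have [lt | ge] := ltnP i n; last first.
    suff -> : i = ord_max by [].
    by apply/val_inj/eqP; rewrite /= eqn_leq ge -ltnS ltn_ord.
  have -> : i = widen_ord (leqnSn n) (Ordinal lt) by apply/val_inj.
  by move/mnmP/(_ (Ordinal lt)): ab; rewrite !mnmE.
case: (m ord_max == k ord_max); last by rewrite andbF !mulr0 mcoeff0.
by rewrite andbT mulr1 mcoeffZ mcoeffX eq_sym.
Qed.

Lemma meval_muni (R : comNzRingType) n (p : {mpoly R[n.+1]}) (v : 'I_n.+1 -> R) :
  p.@[v] = (map_poly (meval (fun i => v (widen_ord (leqnSn n) i))) (muni p)).[v ord_max].
Proof.
rewrite muniE rmorph_sum horner_sum /= mevalE; apply: eq_bigr => m _.
rewrite -!mul_polyC !rmorphM /= !map_polyC /= map_polyXn !hornerM !hornerC hornerXn.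
rewrite mevalZ mevalX big_ord_recr /= mulrA; congr (_ * _ * _).
by apply: eq_bigr => i _; rewrite mnmE.
Qed.

Lemma mpoly_eval0 (F : numFieldType) n (p : {mpoly F[n]}) :
  (forall v, p.@[v] = 0) -> p = 0.
Proof.
elim: n p => [|n IHn] p p0.
  by have := p0 (fun=> 0); rewrite (nvar0_mpolyC p) mevalC => ->; rewrite mpolyC0.
suff mp0 : muni p = 0.
  by apply/mpolyP => m; rewrite -mcoeff_muni mp0 coef0 !mcoeff0.
apply/polyP => i; rewrite coef0; apply: IHn => v.
rewrite -coef_map [map_poly _ _]poly_eval0 ?coef0 // => x.
pose w (j : 'I_n.+1) := if insub (val j) is Some k then v k else x.
have := p0 w; rewrite meval_muni => <-; rewrite {2}/w insubF //= ?ltnn //.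
congr (_.[_]); apply: eq_map_poly => q; apply: meval_eq => k.
by rewrite /w /= insubT //= => lt; congr (v _); apply/val_inj.
Qed.

(** The polynomial with coefficients p_m (t^m - c) vanishes at every point, hence is zero. *)
Lemma meval_weight (F : numFieldType) n (p : {mpoly F[n]}) (t : 'I_n -> F) (c : F) :
  (forall v, p.@[fun i => t i * v i] = c * p.@[v]) ->
  {in msupp p, forall m : 'X_{1..n}, \prod_i t i ^+ m i = c}.
Proof.
move=> tp m mp.
pose q := \sum_(k <- msupp p) (p@_k * (\prod_i t i ^+ k i - c)) *: 'X_[k].
have q0 : q = 0.
  apply: mpoly_eval0 => v; rewrite raddf_sum /=.
  have := tp v; rewrite !mevalE mulr_sumr => /eqP; rewrite -subr_eq0 -sumrB => /eqP e.
  rewrite -[RHS]e; apply: eq_bigr => k _; rewrite mevalZ mevalX.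
  under [in RHS]eq_bigr => i _ do rewrite exprMn.
  by rewrite big_split /= mulrBr mulrBl !mulrA [c * _]mulrC.
have /eqP : q@_m = 0 by rewrite q0 mcoeff0.
rewrite raddf_sum (bigD1_seq m) ?msupp_uniq //= [X in _ + X]big1 => [|k /negPf km].
  rewrite addr0 mcoeffZ mcoeffX eqxx mulr1 mulf_eq0 subr_eq0.
  by rewrite -[p@_m == 0]negbK -mcoeff_msupp mp => /eqP.
by rewrite mcoeffZ mcoeffX km mulr0.
Qed.

End PolynomialFunctions.

(** * The apolar pairing and linear substitutions *)

Section Apolarity.

Variables (n : nat) (R : comNzRingType).
Implicit Types (p q : {mpoly R[n]}) (m : 'X_{1..n}) (H : 'M[R]_n).

(** The constant term of q(d/dX) p: monomials are orthogonal, and X^m pairs with itself to m!. *)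
Definition apolar q p : R :=
  \sum_(m <- msupp q) q@_m * (p@_m * (\prod_i (m i)`!)%:R).

Lemma apolarwE k q p : (msize q <= k)%N ->
  apolar q p = \sum_(m : 'X_{1..n < k}) q@_m * (p@_m * (\prod_i (m i)`!)%:R).
Proof.
move=> qk; pose P (m : 'X_{1..n < k}) := (val m) \in msupp q.
rewrite (bigID P) {}/P /= addrC big1 ?add0r; last first.
  by move=> m /memN_msupp_eq0 ->; rewrite mul0r.
rewrite /apolar (big_mksub 'X_{1..n < k}) //=; first exact/msupp_uniq.
by move=> m /msize_mdeg_lt /leq_trans; apply.
Qed.

Lemma apolar_linearl c q1 q2 p :
  apolar (c *: q1 + q2) p = c * apolar q1 p + apolar q2 p.
Proof.
pose k := maxn (msize (c *: q1 + q2)) (maxn (msize q1) (msize q2)).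
rewrite !(@apolarwE k) ?leq_max ?leqnn ?orbT // mulr_sumr -big_split /=.
by apply: eq_bigr => m _; rewrite mcoeffD mcoeffZ mulrDl -mulrA.
Qed.

Lemma apolar_linearr c q p1 p2 :
  apolar q (c *: p1 + p2) = c * apolar q p1 + apolar q p2.
Proof.
rewrite mulr_sumr -big_split /=; apply: eq_bigr => m _.
by rewrite mcoeffD mcoeffZ mulrDl mulrDr -[c * _ * _]mulrA mulrCA.
Qed.

Lemma apolarDr q p1 p2 : apolar q (p1 + p2) = apolar q p1 + apolar q p2.
Proof. by rewrite -[p1]scale1r apolar_linearr mul1r scale1r. Qed.

Lemma apolar0r q : apolar q 0 = 0.
Proof. by rewrite /apolar big1 // => m _; rewrite mcoeff0 mul0r mulr0. Qed.

Lemma apolar0l p : apolar 0 p = 0.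
Proof. by rewrite /apolar msupp0 big_nil. Qed.

Lemma apolarZr c q p : apolar q (c *: p) = c * apolar q p.
Proof. by rewrite -[c *: p]addr0 apolar_linearr apolar0r addr0. Qed.

Lemma apolarZl c q p : apolar (c *: q) p = c * apolar q p.
Proof. by rewrite -[c *: q]addr0 apolar_linearl apolar0l addr0. Qed.

Lemma apolar_sumr (I : Type) (r : seq I) (P : pred I) q (E : I -> {mpoly R[n]}) :
  apolar q (\sum_(i <- r | P i) E i) = \sum_(i <- r | P i) apolar q (E i).
Proof. exact: (big_morph _ (apolarDr q) (apolar0r q)). Qed.

Lemma apolar_suml (I : Type) (r : seq I) (P : pred I) (E : I -> {mpoly R[n]}) p :
  apolar (\sum_(i <- r | P i) E i) p = \sum_(i <- r | P i) apolar (E i) p.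
Proof.
apply: (big_morph (apolar^~ p) _ (apolar0l p)) => q1 q2.
by rewrite -[q1]scale1r apolar_linearl mul1r scale1r.
Qed.

Lemma apolarXl m p : apolar 'X_[m] p = p@_m * (\prod_i (m i)`!)%:R.
Proof. by rewrite /apolar msuppX big_seq1 mcoeffX eqxx mul1r. Qed.

(** On monomials this is (a+1)! = (a+1) a! for the exponent of X_i. *)
Lemma apolar_mulX i q p : apolar ('X_i * q) p = apolar q p^`M(i).
Proof.
rewrite [q]mpolyE mulr_sumr !apolar_suml; apply: eq_bigr => m _.
rewrite -scalerAr !apolarZl -mpolyXD !apolarXl; congr (_ * _).
rewrite mcoeff_deriv addmC mulrnAl -mulrnAr -mulrnA; congr (_ * _%:R).
rewrite (bigD1 i) //= [in RHS](bigD1 i) //= mnmDE mnm1E eqxx addn1 factS [RHS]mulnC mulnA.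
congr (_ * _)%N; apply: eq_bigr => j /negPf ji.
by rewrite mnmDE mnm1E eq_sym ji addn0.
Qed.

Definition linsub H p : {mpoly R[n]} := p \mPo [tuple \sum_j H i j *: 'X_j | i < n].

HB.instance Definition _ H := GRing.RMorphism.copy (linsub H) (comp_mpoly _).
HB.instance Definition _ H := GRing.Linear.copy (linsub H) (comp_mpoly _).

Lemma linsubX H i : linsub H 'X_i = \sum_j H i j *: 'X_j.
Proof. by rewrite /linsub comp_mpolyXU -tnth_nth tnth_mktuple. Qed.

Lemma linsub1 H : linsub H 1 = 1. Proof. exact: rmorph1. Qed.

Lemma linsubM H : {morph linsub H : p q / p * q}. Proof. exact: rmorphM. Qed.

Lemma linsub_linear H c p q : linsub H (c *: p + q) = c *: linsub H p + linsub H q.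
Proof. exact: linearP. Qed.

Lemma linsub_comp H k (q : {mpoly R[k]}) (lq : k.-tuple {mpoly R[n]}) :
  linsub H (q \mPo lq) = q \mPo [tuple linsub H (tnth lq j) | j < k].
Proof.
elim/mpoly_indX: q => [|c p q IHp IHq|i q IHq]; first by rewrite !rmorph1.
  by rewrite !linearP /= IHp IHq.
by rewrite !rmorphM /= IHq !comp_mpolyXU -!tnth_nth tnth_mktuple.
Qed.

Lemma mderivXU i j : ('X_i : {mpoly R[n]})^`M(j) = (i == j)%:R%:MP.
Proof.
rewrite mderivX mnm1E; case: eqP => [->|_]; last by rewrite scale0r mpolyC0.
rewrite scale1r mpolyC1 -mpolyX0; congr 'X_[_].
by apply/mnmP => k; rewrite mnmBE subnn mnm0E.
Qed.

(** The chain rule for p composed with H. *)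
Lemma mderiv_linsub H j p : (linsub H p)^`M(j) = \sum_i H i j *: linsub H p^`M(i).
Proof.
elim/mpoly_indX: p => [|c p q IHp IHq|k p IHp].
- rewrite linsub1 -mpolyC1 mderivC big1 // => i _.
  by rewrite mderivC /linsub raddf0 scaler0.
- rewrite linsub_linear mderivD mderivZ IHp IHq scaler_sumr -big_split /=.
  apply: eq_bigr => i _; rewrite mderivD mderivZ linsub_linear scalerDr !scalerA.
  by rewrite mulrC.
rewrite linsubM mderivM IHp linsubX.
have -> : (\sum_l H k l *: 'X_l)^`M(j) = (H k j)%:MP.
  rewrite raddf_sum /= (bigD1 j) //= big1 ?addr0 => [|l /negPf lj].
    by rewrite mderivZ mderivXU eqxx -mul_mpolyC mulr1.
  by rewrite mderivZ mderivXU lj mpolyC0 scaler0.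
under [RHS]eq_bigr => i _ do
  rewrite mderivM /linsub raddfD /= -!/(linsub H _) !linsubM linsubX scalerDr.
rewrite big_split /=; congr (_ + _); last first.
  by rewrite mulr_sumr; apply: eq_bigr => i _; rewrite scalerAr.
rewrite (bigD1 k) //= big1 ?addr0 => [|i /negPf ik].
  by rewrite mderivXU eqxx mpolyC1 linsub1 mul1r mul_mpolyC.
by rewrite mderivXU eq_sym ik mpolyC0 /linsub raddf0 mul0r scaler0.
Qed.

Lemma linsub_coef0 H p : (linsub H p)@_0%MM = p@_0%MM.
Proof.
elim/mpoly_indX: p => [|c p q IHp IHq|k p IHp]; first by rewrite linsub1.
  by rewrite linsub_linear !mcoeffD !mcoeffZ IHp IHq.
rewrite linsubM linsubX !rmorphM /= mcoeffX mnm1_eq0 mul0r raddf_sum big1 ?mul0r // => j _.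
by rewrite /= mcoeffZ mcoeffX mnm1_eq0 mulr0.
Qed.

(** Each variable of q turns into a derivative of p, and there the chain rule brings in the entries
    of H transposed. *)
Lemma apolar_linsub H q p : apolar q (linsub H p) = apolar (linsub H^T q) p.
Proof.
elim/mpoly_indX: q p => [|c q1 q2 IH1 IH2|i q IHq] p.
- by rewrite linsub1 -mpolyX0 !apolarXl linsub_coef0.
- by rewrite linsub_linear !apolar_linearl IH1 IH2.
rewrite apolar_mulX mderiv_linsub apolar_sumr linsubM linsubX mulr_suml apolar_suml.
apply: eq_bigr => j _; rewrite apolarZr IHq mxE -scalerAl apolarZl.
by rewrite apolar_mulX.
Qed.

End Apolarity.

(** The pairing involves no conjugation; for real coefficients every term is a square times
    factorials, and the leading monomial gives a positive one. *)
Lemma apolar_gt0 (R : numDomainType) n (q : {mpoly R[n]}) :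
  (forall m, q@_m \is Num.real) -> q != 0 -> 0 < apolar q q.
Proof.
move=> qr q0; rewrite /apolar.
have ge0 m : 0 <= q@_m * (q@_m * (\prod_i (m i)`!)%:R).
  by rewrite mulrA mulr_ge0 ?ler0n // -expr2 -realEsqr.
rewrite lt0r sumr_ge0 // andbT psumr_neq0 //; apply/hasP.
exists (mlead q); first exact: mlead_supp.
rewrite lt0r ge0 andbT !mulf_neq0 ?mleadc_eq0 // pnatr_eq0 -lt0n.
by apply: prodn_gt0 => i; apply: fact_gt0.
Qed.

(** * Right translations of the generic matrix *)

Section GenericMatrix.

Variables (R : comNzRingType) (N : nat).
Local Notation A := {mpoly R[N * N]}.

Definition genmx : 'M[A]_N := \matrix_(i, j) 'X_(mxvec_index i j).

(** The transpose offsets the row-vector convention of [lin_mulmxr]: the generic matrix R is sent to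
    R h. *)
Definition rtrans (h : 'M[R]_N) : A -> A := linsub (lin_mulmxr h^T).

HB.instance Definition _ h := GRing.RMorphism.copy (rtrans h) (linsub _).
HB.instance Definition _ h := GRing.Linear.copy (rtrans h) (linsub _).

Lemma lin_mulmxrE (h : 'M[R]_N) i j k l :
  (lin_mulmxr h : 'M_(N * N)) (mxvec_index i j) (mxvec_index k l) = (i == k)%:R * h j l.
Proof.
rewrite !mxE /= vec_mx_delta mxvecE mxE (bigD1 j) //= big1 ?addr0 => [|s /negPf sj].
  by rewrite mxE eqxx andbT eq_sym.
by rewrite mxE sj andbF mul0r.
Qed.

Lemma tr_lin_mulmxr (h : 'M[R]_N) :
  (lin_mulmxr h : 'M_(N * N))^T = lin_mulmxr h^T.
Proof.
apply/matrixP => s t; case/mxvec_indexP: s => i j; case/mxvec_indexP: t => k l.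
by rewrite mxE !lin_mulmxrE mxE eq_sym.
Qed.

Lemma rtrans_genmx h : map_mx (rtrans h) genmx = genmx *m map_mx (@mpolyC (N * N) R) h.
Proof.
apply/matrixP => i j; rewrite !mxE /rtrans linsubX.
rewrite (reindex _ (curry_mxvec_bij N N)) /=.
transitivity (\sum_k \sum_l (lin_mulmxr h^T : 'M_(N * N)) (mxvec_index i j)
    (mxvec_index k l) *: ('X_(mxvec_index k l) : A)).
  by rewrite pair_bigA; apply: eq_bigr => -[k l].
rewrite (bigD1 i) //= [X in _ + X]big1 ?addr0 => [|k /negPf ki]; last first.
  by rewrite big1 // => l _; rewrite lin_mulmxrE eq_sym ki mul0r scale0r.
apply: eq_bigr => k _.
by rewrite lin_mulmxrE !mxE eqxx mul1r mulrC mul_mpolyC.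
Qed.

Lemma rtrans_det h : rtrans h (\det genmx) = (\det h)%:MP * \det genmx.
Proof. by rewrite -det_map_mx rtrans_genmx det_mulmx det_map_mx mulrC. Qed.

(** The adjoint of right translation by h is that by h^T, under which det^d is only multiplied by a
    scalar. Pairing with det^d is therefore SL-invariant. *)
Lemma apolar_rtrans d h (p : A) :
  apolar (\det genmx ^+ d) (rtrans h p) = \det h ^+ d * apolar (\det genmx ^+ d) p.
Proof.
rewrite /rtrans apolar_linsub tr_lin_mulmxr -/(rtrans h^T _) rmorphXn /= rtrans_det det_tr.
by rewrite exprMn -rmorphXn /= mul_mpolyC apolarZl.
Qed.

End GenericMatrix.

Lemma apolar_det_neq0 (F : numDomainType) N d :
  apolar (\det (genmx F N) ^+ d) (\det (genmx F N) ^+ d) != 0.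
Proof.
(* The determinant is defined over the integers, so its powers have real coefficients. *)
have genmxE : genmx F N = map_mx (map_mpoly (intr : int -> F)) (genmx int N).
  by apply/matrixP => i j; rewrite !mxE map_mpolyX.
rewrite gt_eqF // apolar_gt0 ?expf_neq0 // => [m|].
  by rewrite genmxE det_map_mx -rmorphXn mcoeff_map_mpoly realz.
apply/eqP => /(congr1 (meval (fun k => mxvec (1%:M : 'M[F]_N) 0 k))).
rewrite raddf0 -det_map_mx => /eqP; apply/negP.
have -> : map_mx (meval (fun k => mxvec (1%:M : 'M[F]_N) 0 k)) (genmx F N) = 1%:M.
  by apply/matrixP => i j; rewrite !mxE mevalXU mxvecE mxE.
by rewrite det1 oner_eq0.
Qed.

(** * Polynomials whose coefficients are regular functions of the tensor *)

Section RegularFamilies.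

Variables (F : numClosedFieldType) (I : finType).
Local Notation U := {ffun I -> F}.

(** One closure property serves families of scalars, of multivariate polynomials and of polynomials
    over these. *)
Definition subring_of_families (S : nzRingType) (C : (U -> S) -> Prop) :=
  [/\ forall a, C (fun=> a),
      forall f g, C f -> C g -> C (fun u => f u + g u) &
      forall f g, C f -> C g -> C (fun u => f u * g u)].

Lemma family_sum (S : nzRingType) (C : (U -> S) -> Prop) : subring_of_families C ->
  forall (J : Type) (r : seq J) (P : pred J) (E : U -> J -> S),
  (forall j, P j -> C (E^~ j)) -> C (fun u => \sum_(j <- r | P j) E u j).
Proof.
case=> C1 CD _ J r P E CE; elim: r => [|j r IHr].
  by rewrite (_ : (fun _ => _) = fun=> 0) //; apply/funext => u; rewrite big_nil.
have [Pj | Pj] := boolP (P j).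
  have -> : (fun u => \sum_(k <- j :: r | P k) E u k) =
      fun u => E u j + \sum_(k <- r | P k) E u k.
    by apply/funext => u; rewrite big_cons Pj.
  by apply: CD => //; apply: CE.
have -> : (fun u => \sum_(k <- j :: r | P k) E u k) =
    fun u => \sum_(k <- r | P k) E u k.
  by apply/funext => u; rewrite big_cons (negPf Pj).
exact: IHr.
Qed.

Lemma family_prod (S : nzRingType) (C : (U -> S) -> Prop) : subring_of_families C ->
  forall (J : Type) (r : seq J) (E : U -> J -> S),
  (forall j, C (E^~ j)) -> C (fun u => \prod_(j <- r) E u j).
Proof.
case=> C1 _ CM J r E CE; elim: r => [|j r IHr].
  by rewrite (_ : (fun _ => _) = fun=> 1) //; apply/funext => u; rewrite big_nil.
have -> : (fun u => \prod_(k <- j :: r) E u k) =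
    fun u => E u j * \prod_(k <- r) E u k.
  by apply/funext => u; rewrite big_cons.
exact: CM.
Qed.

Lemma family_exp (S : nzRingType) (C : (U -> S) -> Prop) f k : subring_of_families C ->
  C f -> C (fun u => f u ^+ k).
Proof.
move=> CS Cf; have -> : (fun u => f u ^+ k) = fun u => \prod_(j <- iota 0 k) f u.
  by apply/funext => u; rewrite big_const_seq count_predT size_iota iter_mulr_1.
exact: family_prod.
Qed.

Definition regular (f : U -> F) := exists p, forall u, pvalue p u = f u.

Definition regular_mpoly n (P : U -> {mpoly F[n]}) :=
  forall m, regular (fun u => (P u)@_m).

Definition regular_poly n (Q : U -> {poly {mpoly F[n]}}) :=
  forall j, regular_mpoly (fun u => (Q u)`_j).

Lemma regular_coord i : regular (fun u => u i).
Proof.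
by exists 'X_(enum_rank i) => u; rewrite /pvalue mevalXU enum_rankK.
Qed.

Lemma regular_subring : subring_of_families regular.
Proof.
split=> [a | f g [p hp] [q hq] | f g [p hp] [q hq]].
- by exists a%:MP => u; rewrite /pvalue mevalC.
- by exists (p + q) => u; rewrite /pvalue mevalD -hp -hq.
- by exists (p * q) => u; rewrite /pvalue mevalM -hp -hq.
Qed.

Lemma regular_mpoly_subring n : subring_of_families (@regular_mpoly n).
Proof.
have [C1 CD CM] := regular_subring.
split=> [a m | f g hf hg m | f g hf hg m]; first exact: C1.
  have -> : (fun u => (f u + g u)@_m) = fun u => (f u)@_m + (g u)@_m.
    by apply/funext => u; rewrite mcoeffD.
  exact: CD.
under eq_fun do rewrite mcoeffM.
by apply: (family_sum regular_subring) => k _; apply: CM.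
Qed.

Lemma regular_poly_subring n : subring_of_families (@regular_poly n).
Proof.
have [C1 CD CM] := regular_mpoly_subring n.
split=> [a m | f g hf hg m | f g hf hg m]; first exact: C1.
  by under eq_fun do rewrite coefD; apply: CD.
under eq_fun do rewrite coefM.
by apply: (family_sum (regular_mpoly_subring n)) => k _; apply: CM.
Qed.

Lemma regular_mpolyC n f : regular f -> regular_mpoly (fun u => (f u)%:MP_[n]).
Proof.
have [C1 _ CM] := regular_subring; move=> hf m.
by under eq_fun do rewrite mcoeffC; apply: CM.
Qed.

Lemma regular_polyC n P : regular_mpoly P -> @regular_poly n (fun u => (P u)%:P).
Proof.
have [C1 _ _] := regular_mpoly_subring n; move=> hP j; under eq_fun do rewrite coefC.
by case: (j == 0%N); [apply: hP | apply: C1].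
Qed.

Lemma regular_comp n k (q : {mpoly F[k]}) (h : U -> k.-tuple {mpoly F[n]}) :
  (forall i, regular_mpoly (fun u => tnth (h u) i)) ->
  regular_mpoly (fun u => q \mPo h u).
Proof.
move=> hh; have CS := regular_mpoly_subring n; have [C1 _ CM] := CS.
under eq_fun do rewrite comp_mpolyE.
apply: (family_sum CS) => m _; under eq_fun do rewrite -mul_mpolyC.
apply: CM => //; apply: (family_prod CS) => i; exact: (family_exp (m i) CS (hh i)).
Qed.

Lemma regular_det n k (M : U -> 'M[{poly {mpoly F[n]}}]_k) :
  (forall i j, regular_poly (fun u => M u i j)) -> regular_poly (fun u => \det (M u)).
Proof.
move=> hM; have CS := regular_poly_subring n; have [C1 _ CM] := CS.
apply: (family_sum CS) => s _; apply: CM => //.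
by apply: (family_prod CS) => i; apply: hM.
Qed.

Lemma regular_apolar n (q : {mpoly F[n]}) P :
  regular_mpoly P -> regular (fun u => apolar q (P u)).
Proof.
have [C1 _ CM] := regular_subring; move=> hP; apply: (family_sum regular_subring) => m _.
by apply: (CM) => //; apply: CM.
Qed.

Lemma pvalue_ffun (p : {mpoly F[#|I|]}) (v : 'I_#|I| -> F) :
  p.@[v] = pvalue p [ffun i => v (enum_rank i)].
Proof. by apply: meval_eq => k; rewrite ffunE enum_valK. Qed.

(** The single factor 2 suffices because its powers are distinct. *)
Lemma dhomog_scale2 (p : {mpoly F[#|I|]}) d :
  (forall u : U, pvalue p [ffun i => 2%:R * u i] = 2%:R ^+ d * pvalue p u) ->
  p \is d.-homog.
Proof.
move=> hp; apply/dhomogP => m mp.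
have : \prod_(i < #|I|) (2%:R : F) ^+ m i = 2%:R ^+ d.
  apply: (meval_weight (p := p) _ mp) => v.
  rewrite [in RHS]pvalue_ffun -hp pvalue_ffun; congr pvalue.
  by apply/ffunP => i; rewrite !ffunE.
by rewrite -expr_sum -mdegE -!natrX => /eqP; rewrite eqr_nat eqn_exp2l // => /eqP.
Qed.

End RegularFamilies.

(** * The determinantal covariant *)

Section Pencil.

Variables (F : fieldType) (r N : nat) (S : comNzRingType) (c : {rmorphism F -> S}).
Variables (weight : 'I_r -> S) (z : 'I_N -> S).
Local Notation U := (tensors F r N N N).

Definition pencil (u : U) : 'M[S]_N :=
  \matrix_(v, w) \sum_t weight t * \sum_k c (u (t, (v, w, k))) * z k.

Variables (Phi : {rmorphism S -> S}) (h : 'M[F]_N).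
Hypothesis Phi_c : forall a, Phi (c a) = c a.
Hypothesis Phi_weight : forall t, Phi (weight t) = weight t.
Hypothesis Phi_z : forall k, Phi (z k) = \sum_k' c (h k' k) * z k'.

(** The third group element passes from u to the vector z, where Phi realizes it; the other two act
    as row and column operations. *)
Lemma pencil_act g u : val g.2 = h -> pencil (tensor_act g u) =
  map_mx c (val g.1.1) *m map_mx Phi (pencil u) *m (map_mx c (val g.1.2))^T.
Proof.
case: g => -[g1 g2] g3 /= hE; apply/matrixP => v w; rewrite !mxE.
under [RHS]eq_bigr => w' _ do rewrite !mxE mulr_suml.
rewrite [RHS]exchange_big /=.
under [RHS]eq_bigr => v' _ do under eq_bigr => w' _ do
  rewrite !mxE rmorph_sum mulr_sumr mulr_suml.
under [RHS]eq_bigr => v' _ do rewrite exchange_big /=.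
rewrite [RHS]exchange_big /=; apply: eq_bigr => t _.
transitivity (\sum_v' \sum_w' weight t * (c (val g1 v v') * c (val g2 w w') *
    \sum_k' c (u (t, (v', w', k'))) * \sum_k c (h k k') * z k)); last first.
  apply: eq_bigr => v' _; apply: eq_bigr => w' _.
  rewrite rmorphM /= Phi_weight rmorph_sum /=.
  under [in RHS]eq_bigr => k' _ do rewrite rmorphM /= Phi_c Phi_z.
  by rewrite [RHS]mulrAC [RHS]mulrCA !mulrA.
under [RHS]eq_bigr => v' _ do rewrite -mulr_sumr.
rewrite -mulr_sumr; congr (_ * _).
have actE k : tensor_act (g1, g2, g3) u (t, (v, w, k)) =
    \sum_v' \sum_w' \sum_k' val g1 v v' * val g2 w w' * h k k' * u (t, (v', w', k')).
  by rewrite /tensor_act ffunE -hE.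
under [LHS]eq_bigr => k _ do rewrite actE rmorph_sum mulr_suml.
rewrite exchange_big; apply: eq_bigr => v' _ /=.
under [LHS]eq_bigr => k _ do rewrite rmorph_sum mulr_suml.
rewrite exchange_big; apply: eq_bigr => w' _ /=.
under [LHS]eq_bigr => k _ do rewrite rmorph_sum mulr_suml.
rewrite exchange_big mulr_sumr; apply: eq_bigr => k' _ /=.
rewrite !mulr_sumr; apply: eq_bigr => k _.
by rewrite !rmorphM /= -!mulrA [c (h k k') * _]mulrCA.
Qed.

(** Scaling a tensor amounts to a scalar matrix acting on the third factor alone. *)
Lemma pencil_scale (s : F) (u : U) : h = s%:M ->
  pencil [ffun i => s * u i] = map_mx Phi (pencil u).
Proof.
move=> hE; apply/matrixP => v w; rewrite !mxE.
rewrite rmorph_sum; apply: eq_bigr => t _.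
rewrite rmorphM /= Phi_weight rmorph_sum /=; congr (_ * _); apply: eq_bigr => k _.
rewrite rmorphM /= Phi_c Phi_z (bigD1 k) //= big1 ?addr0 => [|k' /negPf kk'].
  by rewrite ffunE hE mxE eqxx mulr1n rmorphM /= mulrCA mulrA.
by rewrite hE mxE kk' mulr0n rmorph0 mul0r.
Qed.

End Pencil.

Definition pencil_det (F : fieldType) r N (A : idomainType)
    (c : {rmorphism F -> {poly A}}) (e : 'I_r -> nat) (z : 'I_N -> {poly A})
    (u : tensors F r N N N) : {poly A} :=
  \det (pencil c (fun t => 'X^(e t)) z u).

Section DeterminantCovariant.

Variables (F : numClosedFieldType) (r N : nat) (e : 'I_r -> nat).
Local Notation A := {mpoly F[N * N]}.
Local Notation U := (tensors F r N N N).
Local Notation D := (\det (genmx F N)).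

(** Entry k of R^T (1, X, ..., X^(N-1)) for the generic matrix R; its coefficients form column k of
    R. *)
Definition zeta (k : 'I_N) : {poly A} := \sum_(l < N) genmx F N l k *: 'X^l.

Definition pcst : F -> {poly A} := polyC \o @mpolyC (N * N) F.
HB.instance Definition _ := GRing.RMorphism.copy pcst (polyC \o @mpolyC (N * N) F).

Definition covdet (u : U) : {poly A} :=
  pencil_det pcst e zeta u.

Lemma map_pcst h a : map_poly (rtrans h) (pcst a) = pcst a.
Proof. by rewrite /pcst /= map_polyC /= /rtrans /linsub comp_mpolyC. Qed.

Lemma map_weight h t : map_poly (rtrans h) 'X^(e t) = 'X^(e t) :> {poly A}.
Proof. exact: map_polyXn. Qed.

Lemma map_zeta h k :
  map_poly (rtrans h) (zeta k) = \sum_k' pcst (h k' k) * zeta k'.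
Proof.
rewrite rmorph_sum /=.
under [RHS]eq_bigr => k' _ do rewrite mulr_sumr.
rewrite exchange_big; apply: eq_bigr => l _ /=.
rewrite map_polyZ map_polyXn /=.
have := congr1 (fun M : 'M_N => M l k) (rtrans_genmx h); rewrite mxE => ->.
rewrite mxE scaler_suml; apply: eq_bigr => k' _.
by rewrite /pcst /= mul_polyC scalerA mulrC; congr (_ * _ *: _); rewrite mxE.
Qed.

Lemma covdet_act g u :
  covdet (tensor_act g u) = map_poly (rtrans (val g.2)) (covdet u).
Proof.
rewrite /covdet /pencil_det (pencil_act (map_pcst _) (map_weight _) (map_zeta _) _ erefl).
case: g => -[[g1 d1] [g2 d2]] g3 /=; rewrite !det_mulmx det_tr !det_map_mx /=.
by rewrite (eqP d1) (eqP d2) !rmorph1 mul1r mulr1.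
Qed.

Lemma covdet_scale (s : F) (u : U) :
  covdet [ffun i => s * u i] = map_poly (rtrans s%:M) (covdet u).
Proof.
rewrite /covdet /pencil_det -det_map_mx.
by rewrite (pencil_scale (map_pcst _) (map_weight _) (map_zeta _) _ erefl).
Qed.

Lemma regular_covdet : regular_poly covdet.
Proof.
apply: regular_det => v w; have CS := regular_poly_subring F (tensor_index r N N N) (N * N).
have [C1 _ CM] := CS; under eq_fun do rewrite mxE.
apply: (family_sum CS) => t _; apply: (CM) => //; apply: (family_sum CS) => k _.
apply: CM => //; apply/regular_polyC/regular_mpolyC/regular_coord.
Qed.

Variable K : nat.

(** The length K is the same for all tensors, so that one polynomial q can be evaluated on each of
    them. *)
Definition coef_tuple (p : {poly A}) : K.-tuple A := [tuple p`_j | j < K].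

Lemma rtrans_coef_tuple h (q : {mpoly F[K]}) p :
  rtrans h (q \mPo coef_tuple p) = q \mPo coef_tuple (map_poly (rtrans h) p).
Proof.
rewrite /rtrans linsub_comp; congr (_ \mPo _).
by apply/eq_from_tnth => j; rewrite !tnth_mktuple coef_map.
Qed.

Definition covinv d i (q : {mpoly F[K]}) (u : U) : F :=
  apolar (D ^+ d) ((q \mPo coef_tuple (covdet u)) * D ^+ i).

Lemma covinv_act d i q g u : covinv d i q (tensor_act g u) = covinv d i q u.
Proof.
rewrite /covinv covdet_act -rtrans_coef_tuple.
have det1 : \det (val g.2) = 1 by case: g.2 => ? /= /eqP.
have detE : rtrans (val g.2) (D ^+ i) = D ^+ i.
  by rewrite rmorphXn /= rtrans_det det1 mpolyC1 mul1r.
by rewrite -[X in _ * X]detE -rmorphM apolar_rtrans det1 expr1n mul1r.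
Qed.

(** Scaling by s is right translation by a scalar matrix of determinant s^N. The degree is thus N(d
    - i); the factor on the left avoids a division. *)
Lemma covinv_scale d i q (s : F) (u : U) :
  (s ^+ N) ^+ i * covinv d i q [ffun j => s * u j] = (s ^+ N) ^+ d * covinv d i q u.
Proof.
rewrite -{2}[s ^+ N]det_scalar -apolar_rtrans rmorphM /=.
rewrite rtrans_coef_tuple -covdet_scale rmorphXn /= rtrans_det det_scalar.
by rewrite exprMn mulrCA -rmorphXn /= mul_mpolyC apolarZr.
Qed.

Lemma regular_covinv d i q : regular (covinv d i q).
Proof.
apply: regular_apolar; have [C1 _ CM] := regular_mpoly_subring F (tensor_index r N N N) (N * N).
apply: CM => //; apply: regular_comp => j.
by under eq_fun do rewrite tnth_mktuple; apply: regular_covdet.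
Qed.

(** In an integral equation for det R, paired with (det R)^d, invariants of positive degree would
    remove all terms but the leading one, which is nonzero. *)
Lemma notin_nullcone (y : U) : (0 < N)%N ->
  integralOver (comp_mpoly (coef_tuple (covdet y))) D ->
  ~ in_nullcone (@tensor_act F r N N N) y.
Proof.
move=> N0 [p mon_p pD] ynull.
pose d := (size p).-1.
have := apolar_det_neq0 F N d; apply/negP; rewrite negbK.
have : apolar (D ^+ d) (map_poly (comp_mpoly (coef_tuple (covdet y))) p).[D] = 0.
  by rewrite (eqP pD) apolar0r.
have sp : (0 < size p)%N by rewrite size_poly_gt0 monic_neq0.
rewrite horner_poly -(prednK sp) big_ord_recr /= -/d apolarDr apolar_sumr.
rewrite big1 ?add0r => [|i _].
  by rewrite -/(lead_coef p) (monicP mon_p) rmorph1 mul1r => ->.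
have [f hf] := regular_covinv d i p`_i.
rewrite -/(covinv d i p`_i y) -hf; apply: (ynull (N * (d - i))%N).
- by rewrite muln_gt0 N0 subn_gt0 ltn_ord.
- apply: dhomog_scale2 => u; rewrite !hf.
  have nz : (2%:R ^+ N) ^+ i != 0 :> F by rewrite !expf_neq0 // pnatr_eq0.
  apply: (mulfI nz); rewrite covinv_scale mulrA; congr (_ * _).
  by rewrite -!exprM -exprD -mulnDr subnKC // ltnW.
- by move=> g u; rewrite !hf covinv_act.
Qed.

End DeterminantCovariant.

(** * The chain tensor: invariants of low degree *)

Section Torus.

Variables (F : numClosedFieldType) (r N : nat).
Local Notation I := (tensor_index r N N N).
Implicit Types (x : I) (t : 'I_N -> F).

Definition vindex x := x.2.1.1.
Definition windex x := x.2.1.2.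
Definition zindex x := x.2.2.

Definition dmx t : 'M[F]_N := diag_mx (\row_i t i).

Lemma det_dmx t : \prod_i t i = 1 -> \det (dmx t) == 1.
Proof. by move=> t1; rewrite det_diag; under eq_bigr do rewrite mxE; rewrite t1. Qed.

Definition sl_diag t (d : \det (dmx t) == 1) : SL F N :=
  exist (fun g : 'M[F]_N => \det g == 1) (dmx t) d.

Lemma tensor_act_diag t1 t2 t3
    (d1 : \det (dmx t1) == 1) (d2 : \det (dmx t2) == 1) (d3 : \det (dmx t3) == 1)
    (u : tensors F r N N N) x :
  tensor_act (sl_diag d1, sl_diag d2, sl_diag d3) u x =
  t1 (vindex x) * t2 (windex x) * t3 (zindex x) * u x.
Proof.
case: x => s [[i j] k]; rewrite ffunE /= (bigD1 i) //= [X in _ + X]big1 => [|i' /negPf ii'].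
  rewrite (bigD1 j) //= [X in _ + X + _]big1 => [|j' /negPf jj'].
    rewrite (bigD1 k) //= [X in _ + X + _ + _]big1 => [|k' /negPf kk'].
      by rewrite !addr0 !mxE !eqxx !mulr1n.
    by rewrite !mxE [k == k']eq_sym kk' mulr0n mulr0 mul0r.
  by rewrite big1 // => k' _; rewrite !mxE [j == j']eq_sym jj' mulr0n mulr0 !mul0r.
rewrite big1 // => j' _; rewrite big1 // => k' _.
by rewrite !mxE [i == i']eq_sym ii' mulr0n !mul0r.
Qed.

Variables (f : {mpoly F[#|I|]}) (m : 'X_{1..#|I|}).
Hypotheses (f_inv : Defs.invariant (@tensor_act F r N N N) f) (mf : m \in msupp f).

Let c x := m (enum_rank x).

(** The diagonal torus scales each coordinate, so every monomial of an invariant is itself fixed. *)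
Lemma torus_weight t1 t2 t3 :
  \prod_i t1 i = 1 -> \prod_i t2 i = 1 -> \prod_i t3 i = 1 ->
  \prod_x (t1 (vindex x) * t2 (windex x) * t3 (zindex x)) ^+ c x = 1.
Proof.
move=> /det_dmx d1 /det_dmx d2 /det_dmx d3.
pose t x := t1 (vindex x) * t2 (windex x) * t3 (zindex x).
have H : \prod_(k < #|I|) t (enum_val k) ^+ m k = 1.
  apply: (meval_weight (p := f) _ mf) => v; rewrite mul1r [in RHS]pvalue_ffun.
  rewrite -(f_inv (sl_diag d1, sl_diag d2, sl_diag d3)) pvalue_ffun.
  by congr pvalue; apply/ffunP => x; rewrite tensor_act_diag !ffunE enum_rankK.
rewrite -[RHS]H [RHS](reindex _ (onW_bij _ (enum_rank_bij _))).
by apply: eq_bigr => x _; rewrite enum_rankK.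
Qed.

Definition count_at (pi : I -> 'I_N) (a : 'I_N) := (\sum_x (pi x == a) * c x)%N.

(** A diagonal matrix of determinant 1 that compares the uses of the indices a and b; it is the
    identity for a = b. *)
Definition cochar (a b i : 'I_N) : F := 2%:R ^+ (i == a) * 2%:R^-1 ^+ (i == b).

Lemma prod_cochar a b : \prod_i cochar a b i = 1.
Proof.
have sum1 (k : 'I_N) : (\sum_(i < N) (i == k))%N = 1%N.
  by rewrite (bigD1 k) //= eqxx big1 // => i /negPf ->.
by rewrite big_split /= -!expr_sum !sum1 !expr1 divff // pnatr_eq0.
Qed.

Lemma prod_cochar_exp pi a b : \prod_x cochar a b (pi x) ^+ c x = 1 ->
  count_at pi a = count_at pi b.
Proof.
under eq_bigr => x _ do rewrite /cochar exprMn -!exprM.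
rewrite big_split /= -!expr_sum -/(count_at pi a) -/(count_at pi b) exprVn.
move/(canRL (mulfVK _)); rewrite mul1r expf_eq0 pnatr_eq0 andbF => /(_ isT).
by move/eqP; rewrite -!natrX eqr_nat eqn_exp2l // => /eqP.
Qed.

Lemma torus_counts a b :
  [/\ count_at vindex a = count_at vindex b, count_at windex a = count_at windex b &
      count_at zindex a = count_at zindex b].
Proof.
have one : \prod_(i < N) (1 : F) = 1 by rewrite big1.
have ab := prod_cochar a b.
split; apply: prod_cochar_exp.
- by rewrite -[RHS](torus_weight ab one one); apply: eq_bigr => x _; rewrite !mulr1.
- by rewrite -[RHS](torus_weight one ab one); apply: eq_bigr => x _; rewrite mulr1 mul1r.
- by rewrite -[RHS](torus_weight one one ab); apply: eq_bigr => x _; rewrite !mul1r.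
Qed.

Lemma sum_count_at pi : (\sum_a count_at pi a)%N = mdeg m.
Proof.
rewrite mdegE (reindex _ (onW_bij _ (enum_rank_bij I))) exchange_big /=.
apply: eq_bigr => x _; rewrite (bigD1 (pi x)) //= eqxx mul1n big1 ?addn0 // => a.
by rewrite eq_sym => /negPf ->.
Qed.

End Torus.

(** * Exponent counts on the chain tensor *)

Section ChainTensor.

Variables (F : numClosedFieldType) (n : nat).
Local Notation N := (3 * n)%N.
Local Notation I := (tensor_index 9 N N N).

(* Coordinate (a, b) of block i carries the vector of Z with index [label i a b];
   (2, 2) is not used. With t = 4^(n-1-i) and M = 4^n, the multiplicities
     2t    M-4t  2t
     t     t     M-2t
     M-3t  3t    0
   use every index of V, W and Z exactly M times; the last block is closed up
   through the index 1. *)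
Definition label (i a b : nat) : nat :=
  match a, b with
  | 0, 0 | 1, 2 => 3 * i
  | 0, 1 => 3 * i + 1
  | 1, 0 | 2, 1 => 3 * i + 2
  | 1, 1 => if (i.+1 < n)%N then 3 * i.+1 + 1 else 1
  | _, _ => if (i.+1 < n)%N then 3 * i.+1 + 2 else 1
  end.

(** Position (a, b) uses copy 3a + b in every block; [t < 8] excludes (2, 2). *)
Definition chain_support (x : I) : bool :=
  let: (t, (v, w, k)) := x in
  [&& v %/ 3 == w %/ 3, t == (3 * (v %% 3) + w %% 3)%N :> nat, t < 8 &
      k == label (v %/ 3) (v %% 3) (w %% 3) :> nat]%N.

Definition chain_tensor (K : fieldType) : tensors K 9 N N N :=
  [ffun x => (chain_support x)%:R].

Lemma chain_supportE (x : I) : chain_support x ->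
  exists i a b, [/\ (i < n)%N, [&& a < 3, b < 3 & a + b < 4]%N,
    vindex x = (3 * i + a)%N :> nat, windex x = (3 * i + b)%N :> nat &
    zindex x = label i a b :> nat].
Proof.
case: x => t [[v w] k] /= /and4P[/eqP vw /eqP tE t8 /eqP kE].
exists (v %/ 3)%N, (v %% 3)%N, (w %% 3)%N; rewrite /vindex /windex /zindex /=; split=> //.
- by have := ltn_ord v; lia.
- by move: t8; rewrite tE; lia.
- by lia.
- by lia.
Qed.

Lemma chain_counts (c : I -> nat) (M : nat) :
  (forall x, c x != 0%N -> chain_support x) ->
  (forall a : 'I_N, (\sum_x (vindex x == a) * c x = M)%N) ->
  (forall a : 'I_N, (\sum_x (windex x == a) * c x = M)%N) ->
  (forall a : 'I_N, (\sum_x (zindex x == a) * c x = M)%N) ->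
  (0 < n)%N -> (0 < M)%N -> (4 ^ n.-1 <= M)%N.
Proof.
move=> supp cV cW cZ n0 M0.
(* [S P] is the total multiplicity of the coordinates satisfying P, and [W i a b] that of position
   (a, b) in block i. *)
pose S (P : nat -> nat -> nat -> nat) := (\sum_x P (vindex x) (windex x) (zindex x) * c x)%N.
pose W i a b := S (fun v w _ => (v == 3 * i + a)%N && (w == 3 * i + b)%N).
have SD P Q : (S P + S Q = S (fun v w z => P v w z + Q v w z))%N.
  by rewrite /S -big_split; apply: eq_bigr => x _; rewrite /= mulnDl.
have SE P Q : (forall j a b, (j < n)%N -> [&& a < 3, b < 3 & a + b < 4]%N ->
    P (3 * j + a) (3 * j + b) (label j a b) =
    Q (3 * j + a) (3 * j + b) (label j a b))%N -> S P = S Q.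
  move=> PQ; apply: eq_bigr => x _; have [->|/supp] := eqVneq (c x) 0%N.
    by rewrite !muln0.
  by case/chain_supportE => j [a [b [jn ab -> -> ->]]]; rewrite PQ.
have SV v : (v < N)%N -> S (fun v' _ _ => (v' == v)) = M by move=> vN; apply: (cV (Ordinal vN)).
have SW w : (w < N)%N -> S (fun _ w' _ => (w' == w)) = M by move=> wN; apply: (cW (Ordinal wN)).
have SZ z : (z < N)%N -> S (fun _ _ z' => (z' == z)) = M by move=> zN; apply: (cZ (Ordinal zN)).
have eqV i a : (i < n)%N -> (a < 3)%N -> (W i a 0 + W i a 1 + W i a 2 = M)%N.
  move=> ltin a3; rewrite -(SV (3 * i + a)%N); last by lia.
  by rewrite !SD; apply: SE => j a' b' ltjn /=; lia.
have eqW i b : (i < n)%N -> (b < 3)%N -> (W i 0 b + W i 1 b + W i 2 b = M)%N.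
  move=> ltin b3; rewrite -(SW (3 * i + b)%N); last by lia.
  by rewrite !SD; apply: SE => j a' b' ltjn /=; lia.
have W22 i : W i 2%N 2%N = 0%N.
  transitivity (S (fun _ _ _ => 0%N)); last by rewrite /S big1.
  by apply: SE => j a' b' ltjn /=; lia.
have eqZ0 i : (i < n)%N -> (W i 0 0 + W i 1 2 = M)%N.
  move=> ltin; rewrite -(SZ (3 * i)%N); last by lia.
  rewrite SD; apply: SE => j [|[|[|a]]] [|[|[|b]]] ltjn //= _; try case: ifP; lia.
have eqZ1 i : (i.+1 < n)%N -> (W i.+1 0 1 + W i 1 1 = M)%N.
  move=> ltin; rewrite -(SZ (3 * i.+1 + 1)%N); last by lia.
  by rewrite SD; apply: SE => j [|[|[|a]]] [|[|[|b]]] ltjn //= _; try case: ifP; lia.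
have eqZ2 i : (i.+1 < n)%N -> (W i.+1 1 0 + W i.+1 2 1 + W i 0 2 + W i 2 0 = M)%N.
  move=> ltin; rewrite -(SZ (3 * i.+1 + 2)%N); last by lia.
  by rewrite !SD; apply: SE => j [|[|[|a]]] [|[|[|b]]] ltjn //= _; try case: ifP; lia.
have eqZ20 : (W 0 1 0 + W 0 2 1 = M)%N.
  rewrite -(SZ 2%N); last by lia.
  by rewrite !SD; apply: SE => j [|[|[|a]]] [|[|[|b]]] ltjn //= _; try case: ifP; lia.
pose s i := (W i 0 2 + W i 1 0)%N.
have block i : (i < n)%N -> [/\ W i 0 1 + W i 0 2 + W i 0 2 = M, W i 1 1 + W i 1 0 = W i 0 2,
    W i 2 1 = W i 0 2 + W i 1 0 & W i 2 0 + W i 0 2 + W i 1 0 = M]%N.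
  move=> ltin; have := (eqV i 0 ltin isT, eqV i 1 ltin isT, eqV i 2 ltin isT)%N.
  move=> [[]]; move: (eqW i 0 ltin isT)%N (eqW i 1 ltin isT)%N (eqW i 2 ltin isT)%N.
  by move: (eqZ0 i ltin) (W22 i) => *; split; lia.
(* The Z-equations for the two shared indices give W11 = 2 W'02 and W10 = W'10 + s', primes marking
   block i+1; then s = W02 + W10 = 2 W10 + W11 = 4s'. *)
have sE i : (i.+1 < n)%N -> s i = (4 * s i.+1)%N.
  move=> ltin; have [] := block i (ltnW ltin); have [] := block i.+1 ltin.
  by move: (eqZ1 i ltin) (eqZ2 i ltin); rewrite /s; lia.
have s0E k : (k < n)%N -> s 0%N = (4 ^ k * s k)%N.
  elim: k => [|k IHk] lt; first by rewrite mul1n.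
  by rewrite IHk 1?ltnW // sE // expnSr mulnA.
(* No block precedes block 0, so index 2 of Z gives W10 + s = M there. Since W10 <= s, this yields 0
   < s <= M. *)
have [] := block 0%N n0; move: eqZ20 => eqZ20 e1 e2 e3 e4.
have s0M : (s 0%N <= M)%N by rewrite /s; lia.
have s0_gt0 : (0 < s 0%N)%N by rewrite /s; lia.
apply: leq_trans s0M; move: s0_gt0; rewrite (s0E n.-1) ?prednK //.
by rewrite muln_gt0 => /andP[_]; apply: leq_pmulr.
Qed.

Lemma chain_low_degree d (f : {mpoly F[#|I|]}) : (0 < n)%N -> (0 < d)%N ->
  f \is d.-homog -> Defs.invariant (@tensor_act F 9 N N N) f ->
  pvalue f (chain_tensor F) != 0 -> (4 ^ n - 1 <= d)%N.
Proof.
move=> n0 d0 /dhomogP f_homog f_inv; rewrite /pvalue mevalE => fy.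
(* Some monomial of f is nonzero at the chain tensor, hence involves only coordinates in its
   support. *)
have /hasP[m mf /prodf_neq0 ym] : has (fun m : 'X_{1..#|I|} =>
    \prod_k chain_tensor F (enum_val k) ^+ m k != 0) (msupp f).
  apply: contraNT fy => /hasPn H; rewrite big1_seq // => m /= mf.
  by have /negPn/eqP -> := H m mf; rewrite mulr0.
have dm : mdeg m = d := f_homog m mf.
have N0 : (0 < N)%N by rewrite muln_gt0.
pose a0 := Ordinal N0; pose M := count_at m (@vindex 9 N) a0.
have dE : d = (N * M)%N.
  rewrite -dm -(sum_count_at m (@vindex 9 N)).
  rewrite (eq_bigr (fun=> M)) => [|a _]; last by case: (torus_counts f_inv mf a a0).
  by rewrite sum_nat_const card_ord.
have cW : count_at m (@windex 9 N) a0 = M.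
  apply/eqP; rewrite -(eqn_pmul2l N0) -dE -dm -(sum_count_at m (@windex 9 N)).
  rewrite [X in _ == X](eq_bigr (fun=> count_at m (@windex 9 N) a0)) ?sum_nat_const ?card_ord // => a _.
  by case: (torus_counts f_inv mf a a0).
have cZ : count_at m (@zindex 9 N) a0 = M.
  apply/eqP; rewrite -(eqn_pmul2l N0) -dE -dm -(sum_count_at m (@zindex 9 N)).
  rewrite [X in _ == X](eq_bigr (fun=> count_at m (@zindex 9 N) a0)) ?sum_nat_const ?card_ord // => a _.
  by case: (torus_counts f_inv mf a a0).
have M0 : (0 < M)%N by move: d0; rewrite dE muln_gt0 => /andP[].
have : (4 ^ n.-1 <= M)%N.
  apply: (chain_counts (c := fun x => m (enum_rank x))) => // [x|a|a|a].
  - have := ym (enum_rank x) isT; rewrite enum_rankK ffunE.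
    by case: (chain_support x) => //; rewrite expf_eq0 eqxx andbT -lt0n => /negPf->.
  - by case: (torus_counts f_inv mf a a0).
  - by case: (torus_counts f_inv mf a a0) => _ + _; rewrite cW.
  - by case: (torus_counts f_inv mf a a0) => _ _; rewrite cZ.
(* Here d = 3nM with M >= 4^(n-1): for n = 1 the bound is 3 = 4 - 1, and for larger n one has 3n >=
   4. *)
have : (4 ^ n = 4 * 4 ^ n.-1)%N by rewrite -expnS prednK.
have : n = 1%N -> (4 ^ n.-1 = 1)%N by move=> ->.
by rewrite dE; case: (ltngtP n 1%N) n0 M0; nia.
Qed.

End ChainTensor.

(** * The chain tensor: integrality of the generic determinant *)

Section BlockDeterminant.

Variable S : comNzRingType.

Definition block_mx3 m (G : nat -> nat -> nat -> S) : 'M[S]_m :=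
  \matrix_(v, w) if (v %/ 3 == w %/ 3)%N then G (v %/ 3)%N (v %% 3)%N (w %% 3)%N else 0.

(** The separate size m lets the first block be split off as 3 + 3n. *)
Lemma det_block_mx3 n m (G : nat -> nat -> nat -> S) : (3 * n = m)%N ->
  \det (block_mx3 m G) = \prod_(i < n) \det (\matrix_(a < 3, b < 3) G i a b).
Proof.
elim: n m G => [|n IHn] m G; first by rewrite muln0 => <-; rewrite det_mx00 big_ord0.
rewrite mulnS => <-; rewrite big_ord_recl /= -(IHn _ (fun i => G i.+1) erefl).
have -> : block_mx3 (3 + 3 * n) G =
    block_mx (\matrix_(a < 3, b < 3) G 0%N a b) 0 0
      (block_mx3 (3 * n) (fun i => G i.+1)).
  apply/matrixP => v w; rewrite !mxE.
  case: splitP => v' vE; rewrite !mxE; case: splitP => w' wE; rewrite !mxE vE wE.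
  - by rewrite !divn_small // !modn_small.
  - by rewrite divn_small // divnDl // divnn /= add1n.
  - by rewrite [(w' %/ 3)%N]divn_small // divnDl // divnn /= add1n.
  - by rewrite !divnDl // !divnn /= !add1n eqSS !modnDl.
by rewrite det_ublock.
Qed.

Lemma det_mx33 (G : nat -> nat -> S) : \det (\matrix_(a < 3, b < 3) G a b) =
  G 0%N 0%N * G 1%N 1%N * G 2%N 2%N - G 0%N 0%N * G 1%N 2%N * G 2%N 1%N
  - G 0%N 1%N * G 1%N 0%N * G 2%N 2%N + G 0%N 1%N * G 1%N 2%N * G 2%N 0%N
  + G 0%N 2%N * G 1%N 0%N * G 2%N 1%N - G 0%N 2%N * G 1%N 1%N * G 2%N 0%N.
Proof.
have det2 (M : 'M[S]_2) : \det M = M 0 0 * M 1 1 - M 0 1 * M 1 0.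
  rewrite (expand_det_row _ ord0) !big_ord_recl big_ord0 /cofactor !det_mx11 !mxE /=.
  rewrite expr0 expr1 !mul1r mulN1r mulrN addr0.
  by congr (_ * _ - _ * _); congr (M _ _); apply: val_inj.
rewrite (expand_det_row _ ord0) !big_ord_recl big_ord0 /cofactor !det2 !mxE /= /bump /=.
by rewrite addr0 expr0 expr1 expr2; ring.
Qed.

End BlockDeterminant.

Section ChainPencil.

Variables (F : fieldType) (n : nat) (S : comNzRingType).
Local Notation N := (3 * n)%N.
Variables (c : {rmorphism F -> S}) (weight : nat -> S) (z : 'I_N -> S).

Definition znat (k : nat) : S := if insub k is Some i then z i else 0.

Lemma label_lt i a b : (i < n)%N -> (label n i a b < N)%N.
Proof.
by case: a => [|[|[|a]]]; case: b => [|[|[|b]]] /=; do ?case: ifP; lia.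
Qed.

Definition chain_block i a b : S :=
  if (3 * a + b < 8)%N then weight (3 * a + b)%N * znat (label n i a b) else 0.

(** At position (a, b) of a block only copy 3a + b contributes, through a single basis vector of
    Z. *)
Lemma chain_pencil :
  pencil c (fun t : 'I_9 => weight t) z (chain_tensor n F) = block_mx3 N chain_block.
Proof.
apply/matrixP => v w; rewrite !mxE.
have y0 (t : 'I_9) k : ~~ chain_support (t, (v, w, k)) ->
    c (chain_tensor n F (t, (v, w, k))) * z k = 0.
  by move=> /negPf ns; rewrite ffunE ns rmorph0 mul0r.
case: eqP => vw; last first.
  rewrite big1 // => t _; rewrite big1 ?mulr0 // => k _; apply: y0 => /=.
  by case: eqP vw.
set a := (v %% 3)%N; set b := (w %% 3)%N.
have ab9 : (3 * a + b < 9)%N by rewrite /a /b; lia.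
rewrite (bigD1 (Ordinal ab9)) //= [X in _ + X]big1 ?addr0 => [|t /eqP tab]; last first.
  rewrite big1 ?mulr0 // => k _; apply: y0; rewrite /= negb_and; apply/orP; right.
  by rewrite negb_and; apply/orP; left; apply/eqP => tE; apply: tab; apply/val_inj.
rewrite /chain_block; case: ifP => ab8; last first.
  by rewrite big1 ?mulr0 // => k _; apply: y0; rewrite /= ab8 !andbF.
have vn : (v %/ 3 < n)%N by have := ltn_ord v; lia.
have lN := label_lt a b vn.
rewrite (bigD1 (Ordinal lN)) //= [X in _ * (_ + X)]big1 ?addr0 => [|k /eqP kl]; last first.
  apply: y0; apply/negP => /= /and4P[_ _ _ /eqP kE]; apply: kl; exact/val_inj.
have -> : chain_tensor n F (Ordinal ab9, (v, w, Ordinal lN)) = 1.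
  by rewrite ffunE (_ : chain_support _) //; apply/and4P; split=> //=; apply/eqP.
by rewrite rmorph1 mul1r /znat insubT.
Qed.

End ChainPencil.

Section ChainIntegrality.

Variables (B : comNzRingType) (A : idomainType) (phi : {rmorphism B -> A}) (n : nat).
Local Notation N := (3 * n)%N.
Variable z : 'I_N -> {poly A}.
Hypothesis size_z : forall k, (size (z k) <= N)%N.

Local Notation L := (3 * N)%N.

(* These exponents keep apart, as polynomials in X, the four monomials of
   degree 3 in the determinant of a block. *)
Definition chain_exp (t : nat) : nat := nth 0%N [:: 2 * L; L; 0; 3 * L]%N t.

Local Notation zl i a b := (znat z (label n i a b)).

(** The four Leibniz products avoiding (2, 2), numbered so that product s comes with X^(sL). *)
Definition chain_term (s i : nat) : {poly A} :=
  match s with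
  | 0%N => zl i 0 2 * zl i 1 1 * zl i 2 0
  | 1%N => zl i 0 1 * zl i 1 2 * zl i 2 0
  | 2%N => zl i 0 0 * zl i 1 2 * zl i 2 1
  | _ => zl i 0 2 * zl i 1 0 * zl i 2 1
  end.

Definition chain_det i : {poly A} :=
  \det (\matrix_(a < 3, b < 3) chain_block (fun t => 'X^(chain_exp t)) z i a b).

Lemma chain_detE i : chain_det i =
  - chain_term 0 i + 'X^L * chain_term 1 i - 'X^(2 * L) * chain_term 2 i
  + 'X^(3 * L) * chain_term 3 i.
Proof.
rewrite /chain_det (@det_mx33 _ (chain_block _ z i)) /chain_block /= !expr0 /=.
by ring.
Qed.

Lemma pencil_det_chain (F : fieldType) (c : {rmorphism F -> {poly A}}) :
  pencil_det c (fun t : 'I_9 => chain_exp t) z (chain_tensor n F) =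
  \prod_(i < n) chain_det i.
Proof.
by rewrite /pencil_det (chain_pencil c (fun t => 'X^(chain_exp t))) (@det_block_mx3 _ n).
Qed.

Lemma size_znat k : (size (znat z k) <= N)%N.
Proof. by rewrite /znat; case: insub => [j|]; rewrite ?size_z ?size_poly0. Qed.

Lemma size_chain_term s i : (size (chain_term s i) <= L)%N.
Proof.
have sizeM (p q : {poly A}) a b :
    (size p <= a -> size q <= b -> size (p * q)%R <= a + b)%N.
  move=> pa qb; rewrite (leq_trans (size_polyMleq _ _)) //.
  by rewrite (leq_trans (leq_pred _)) // leq_add.
have size3 k1 k2 k3 : (size (znat z k1 * znat z k2 * znat z k3)%R <= L)%N.
  rewrite mulSn mul2n -addnn addnA.
  by apply: (sizeM); [apply: sizeM|]; apply: size_znat.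
by case: s => [|[|[|s]]]; apply: size3.
Qed.

(** Each term has size at most L, so the shifts by multiples of L do not overlap: coefficient j of
    term s is, up to sign, coefficient sL + j of the determinant. *)
Lemma chain_det_sub s i : sub_coef phi (chain_term s i) (chain_det i).
Proof.
have int1 : integralOver phi 1 by apply: integral1.
have intN1 : integralOver phi (-1) by apply: integral_opp.
have big s' k : (L <= k)%N -> (chain_term s' i)`_k = 0.
  by move=> Lk; rewrite nth_default // (leq_trans (size_chain_term _ _)).
move=> j; have [jL | Lj] := ltnP j L; last first.
  by exists 0; [apply: integral0 | exists 0%N; rewrite mul0r big].
have coefE k : (chain_det i)`_k =
    - (chain_term 0 i)`_k + (if (k < 1 * L)%N then 0 else (chain_term 1 i)`_(k - 1 * L))
    - (if (k < 2 * L)%N then 0 else (chain_term 2 i)`_(k - 2 * L))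
    + (if (k < 3 * L)%N then 0 else (chain_term 3 i)`_(k - 3 * L)).
  by rewrite chain_detE !coefD !coefN !coefXnM mul1n.
have lt1 a b : (a < b)%N -> (a * L + j < b * L)%N.
  by move=> ab; rewrite (leq_trans (n := a.+1 * L)) ?leq_mul2r ?ab ?orbT // mulSn addnC ltn_add2r.
have ge1 a b : (b <= a)%N -> (a * L + j < b * L)%N = false.
  by move=> ba; rewrite ltnNge (leq_trans _ (leq_addr _ _)) // leq_mul2r ba orbT.
have sub1 a : (a.+1 * L + j - a.+1 * L = j)%N by rewrite addKn.
have big1 s' a b : (b < a)%N -> (chain_term s' i)`_(a * L + j - b * L) = 0.
  move=> ba; rewrite big // -[leqLHS](addKn (b * L)) leq_sub2r //.
  by rewrite addnC -mulSn (leq_trans _ (leq_addr _ _)) // leq_mul2r ba orbT.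
have big0 s' a : (chain_term s' i)`_(a.+1 * L + j) = 0.
  by have := @big1 s' a.+1 0%N isT; rewrite mul0n subn0.
case: s => [|[|[|s]]].
- exists (-1) => //; exists (0 * L + j)%N; rewrite coefE.
  by rewrite !lt1 // subr0 !addr0 mulN1r opprK.
- exists 1 => //; exists (1 * L + j)%N; rewrite coefE mul1r.
  rewrite ge1 // !lt1 // big0 sub1; ring.
- exists (-1) => //; exists (2 * L + j)%N; rewrite coefE.
  rewrite (ge1 2 1)%N // (ge1 2 2)%N // lt1 // big0 big1 // sub1; ring.
- exists 1 => //; exists (3 * L + j)%N; rewrite coefE.
  rewrite !ge1 // big0 (big1 1 3 1)%N // (big1 2 3 2)%N // sub1; ring.
Qed.

Lemma int_chain_terms (s : nat -> nat) :
  int_coef phi (\prod_(i < n) chain_det i) ->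
  int_coef phi (\prod_(i < n) chain_term (s i) i).
Proof.
rewrite -[X in int_coef _ X -> _]mulr1 -[X in _ -> int_coef _ X]mulr1.
by apply: int_coef_replace_prod => i; apply: chain_det_sub.
Qed.

Lemma prod_steps (S : comNzRingType) (f : nat -> S) M a1 a2 a3 a4 :
  (a1 + a2 + a3 + a4 = M)%N ->
  \prod_(t < M) f (if (t < a1) then 0 else if (t < a1 + a2) then 3
    else if (t < a1 + a2 + a3) then 2 else 1)%N =
  f 0%N ^+ a1 * f 3%N ^+ a2 * f 2%N ^+ a3 * f 1%N ^+ a4.
Proof.
move=> <-; have prod_const_ord a (g : 'I_a -> nat) k : (forall t, g t = k) ->
    \prod_(t < a) f (g t) = f k ^+ a.
  move=> gk; under eq_bigr => t _ do rewrite gk.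
  by rewrite prodr_const card_ord.
rewrite !big_split_ord /=; congr (_ * _ * _ * _).
all: by apply: prod_const_ord => t; have := ltn_ord t; do ?case: ifP; lia.
Qed.

Lemma prod_triples (S : comNzRingType) (f : nat -> S) m :
  \prod_(k < 3 * m) f k = \prod_(i < m) (f (3 * i)%N * f (3 * i + 1)%N * f (3 * i + 2)%N).
Proof.
rewrite -(big_mkord xpredT f); elim: m => [|m IHm]; first by rewrite big_nil big_ord0.
rewrite mulnS addnC addn3 !big_nat_recr //= IHm big_ord_recr /= addn1 addn2.
by rewrite !mulrA.
Qed.

(** Here r0, r1, r2 stand for the entries of z at 3i, 3i+1, 3i+2, and q1, q2 for those at the labels
    of (1, 1) and (0, 2); k will be M - 4t. *)
Lemma chain_term_exp (S : comNzRingType) (r0 r1 r2 q1 q2 : S) t k :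
  (q2 * q1 * q2) ^+ t * (q2 * r2 * r2) ^+ t * (r0 * r0 * r2) ^+ (2 * t) *
    (r1 * r0 * q2) ^+ k =
  r0 ^+ (4 * t + k) * (r1 ^+ k * r2 ^+ (4 * t)) * (q1 ^+ t * q2 ^+ (3 * t + k)).
Proof. by rewrite (mulnC 2 t) (mulnC 3 t) (mulnC 4 t) !exprD !exprM !exprMn; ring. Qed.

Lemma prod_telescope (S : comNzRingType) (u v w : nat -> S) m :
  v m * u 0%N = w 0%N -> (forall i, (i < m)%N -> v i * u i.+1 = w i.+1) ->
  \prod_(i < m.+1) u i * \prod_(i < m.+1) v i = \prod_(i < m.+1) w i.
Proof.
move=> vu0 vu.
have wE : \prod_(i < m) w i.+1 = \prod_(i < m) v i * \prod_(i < m) u i.+1.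
  by rewrite -big_split; apply: eq_bigr => i _; rewrite /= vu.
rewrite big_ord_recl big_ord_recr [RHS]big_ord_recl /=.
by rewrite -vu0 [X in _ = _ * X]wE; ring.
Qed.

(** The multiplicities are those listed at [label]. The factors [v i] that block i puts on the next
    block complete [u i.+1] to M-th powers. *)
Lemma chain_telescope : (0 < n)%N ->
  \prod_(i < n) (chain_term 0 i ^+ (4 ^ (n.-1 - i)) * chain_term 3 i ^+ (4 ^ (n.-1 - i))
     * chain_term 2 i ^+ (2 * 4 ^ (n.-1 - i))
     * chain_term 1 i ^+ (4 ^ n - 4 * 4 ^ (n.-1 - i))) =
  \prod_k z k ^+ (4 ^ n).
Proof.
move=> n0; pose t i := (4 ^ (n.-1 - i))%N; pose M := (4 ^ n)%N.
have tM i : (4 * t i <= M)%N.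
  by rewrite /t /M -expnS leq_exp2l //; lia.
pose u i := znat z (3 * i + 1) ^+ (M - 4 * t i) * znat z (3 * i + 2) ^+ (4 * t i).
pose v i := zl i 1 1 ^+ t i * zl i 0 2 ^+ (M - t i).
pose w i := znat z (3 * i + 1) ^+ M * znat z (3 * i + 2) ^+ M.
transitivity (\prod_(i < n) znat z (3 * i) ^+ M *
    (\prod_(i < n) u i * \prod_(i < n) v i)).
  rewrite -big_split -big_split /=; apply: eq_bigr => i _.
  rewrite chain_term_exp -/(t i) -/M subnKC // /u /v -mulrA.
  by congr (_ * (_ * (_ * _ ^+ _))); have := tM i; lia.
have -> : \prod_k z k ^+ M = \prod_(k < N) znat z k ^+ M.
  by apply: eq_bigr => k _; rewrite /znat valK.
rewrite (prod_triples (fun k => znat z k ^+ M)).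
rewrite [RHS](eq_bigr (fun i : 'I_n => znat z (3 * i) ^+ M * w i)) => [|i _]; last by rewrite mulrA.
rewrite [RHS]big_split /=; congr (_ * _).
have [m mE] : exists m, n = m.+1 by exists n.-1; rewrite prednK.
have tE i : (i < m)%N -> (4 * t i.+1 = t i)%N.
  by move=> im; rewrite /t mE /= -expnS; congr (4 ^ _)%N; lia.
have t0 : (4 * t 0%N = M)%N by rewrite /t /M mE subn0 -expnS.
have tm : t m = 1%N by rewrite /t mE /= subnn.
have l11 i : label n i 1 1 = (if i < m then 3 * i.+1 + 1 else 1)%N.
  by rewrite /label {1}mE ltnS.
have l02 i : label n i 0 2 = (if i < m then 3 * i.+1 + 2 else 1)%N.
  by rewrite /label {1}mE ltnS.
have P : \prod_(i < m.+1) u i * \prod_(i < m.+1) v i = \prod_(i < m.+1) w i.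
  apply: prod_telescope => [|i im]; rewrite /u /v /w l11 l02.
    (* Closing up: [u 0] involves only index 2, as 4t = M in block 0, and the last block gives index
       1 the exponent 1 + (M - 1). *)
    by rewrite ltnn t0 subnn expr0 mul1r -exprD subnKC // tm /M expn_gt0.
  have tiM : (t i <= M)%N by apply: leq_trans (tM i); rewrite leq_pmull.
  by rewrite im tE // mulrACA -!exprD subnKC // subnK.
by move: P; rewrite -mE.
Qed.

Lemma int_chain (j : 'I_N -> nat) : (0 < n)%N ->
  int_coef phi (\prod_(i < n) chain_det i) ->
  integralOver phi (\prod_k (z k)`_(j k)).
Proof.
move=> n0 hD; apply: (@int_prodX_coef _ _ phi _ _ z (4 ^ n)%N); first by rewrite expn_gt0.
rewrite -chain_telescope //.
(* [sel i s] is the term taken from block i in the s-th of the 4^n products; terms 0, 3, 2, 1 are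
   taken t, t, 2t and 4^n - 4t times. *)
pose t i := (4 ^ (n.-1 - i))%N; pose sel i (s : nat) := (if s < t i then 0
  else if s < t i + t i then 3 else if s < t i + t i + 2 * t i then 2 else 1)%N.
rewrite (_ : \prod_(i < n) _ =
    \prod_(s < 4 ^ n) \prod_(i < n) chain_term (sel i s) i).
  by apply: int_coef_prod => s _; apply: (int_chain_terms (sel^~ s)).
rewrite exchange_big; apply: eq_bigr => i _ /=.
apply/esym/(prod_steps (chain_term^~ i)).
have : (4 * t i <= 4 ^ n)%N by rewrite -expnS leq_exp2l //; lia.
by rewrite /t; lia.
Qed.

End ChainIntegrality.

(** * The chain tensor lies outside the null cone *)

Section ChainNullcone.

Variables (F : numClosedFieldType) (n : nat).
Hypothesis n0 : (0 < n)%N.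
Local Notation N := (3 * n)%N.
Local Notation A := {mpoly F[N * N]}.

Lemma coef_zeta k (l : 'I_N) : (@zeta F N k)`_l = genmx F N l k.
Proof.
rewrite coef_sum (bigD1 l) //= big1 => [|i /negPf il].
  by rewrite coefZ coefXn eqxx mulr1 addr0.
by rewrite coefZ coefXn eq_sym [_ == _]il mulr0.
Qed.

Lemma size_zeta k : (size (@zeta F N k) <= N)%N.
Proof.
rewrite (leq_trans (size_sum _ _ _)) //; apply/bigmax_leqP => l _.
by rewrite (leq_trans (size_scale_leq _ _)) // size_polyXn.
Qed.

Let e (t : 'I_9) := chain_exp n t.
Let p := covdet e (chain_tensor n F).

Lemma covdet_chain : p = \prod_(i < n) chain_det (@zeta F N) i.
Proof. exact: pencil_det_chain. Qed.

Lemma det_integral :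
  integralOver (comp_mpoly (coef_tuple (size p) p)) (\det (genmx F N)).
Proof.
set phi := comp_mpoly _.
have int_p : int_coef phi p.
  move=> j; have [jp | pj] := ltnP j (size p); last first.
    by rewrite nth_default //; apply: integral0.
  have -> : p`_j = phi 'X_(Ordinal jp).
    by rewrite /phi comp_mpolyXU -tnth_nth tnth_mktuple.
  exact: integral_id.
(* After transposition each Leibniz term is a product of one coefficient from every [zeta k]. *)
rewrite -det_tr; apply: int_sum => s _; apply: integral_mul; first exact: int_signr.
under eq_bigr => k _ do rewrite mxE -coef_zeta.
apply: (int_chain size_zeta) => //; rewrite -covdet_chain.
exact: int_p.
Qed.

Lemma chain_notin_nullcone :
  ~ in_nullcone (@tensor_act F 9 N N N) (chain_tensor n F).
Proof. by apply: notin_nullcone det_integral; rewrite muln_gt0. Qed.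

End ChainNullcone.

(** * Comparison of sigma and beta *)

Lemma le_least (P : nat -> Prop) (k : nat) :
  (forall D, P D -> (k <= D)%N) -> ((k%:Z)%:E <= least P)%E.
Proof.
move=> kP; rewrite /least; case: pselect => [exP|_]; last by rewrite leey.
by case: ex_minnP => m /asboolP Pm _; rewrite lee_fin lez_nat kP.
Qed.

Lemma least_anti (P Q : nat -> Prop) :
  (forall D, Q D -> P D) -> (least P <= least Q)%E.
Proof.
move=> QP; rewrite {2}/least; case: pselect => [exQ|_]; last by rewrite leey.
case: ex_minnP => m /asboolP/QP Pm _.
have [|nP] := pselect (exists D, `[< P D >]); last by case: nP; exists m; apply/asboolP.
case=> D PD; rewrite /least; case: pselect => [exP|nP]; last by case: nP; exists D.
by case: ex_minnP => k _ min_k; rewrite lee_fin lez_nat min_k //; apply/asboolP.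
Qed.

Section SigmaBeta.

Variables (F : numClosedFieldType) (I : finType) (G : Type).
Variable act : G -> {ffun I -> F} -> {ffun I -> F}.

Lemma pvalue_homog0 d (p : {mpoly F[#|I|]}) :
  p \is d.-homog -> (0 < d)%N -> pvalue p [ffun=> 0] = 0.
Proof.
move=> /dhomogP p_homog d0; rewrite /pvalue mevalE big1_seq // => m /= /p_homog /= md.
have [k mk] : exists k, m k != 0%N.
  apply/existsP; apply: contraLR d0 => /existsPn m0; rewrite -md mdegE big1 // => k _.
  by apply/eqP; rewrite -[_ == _]negbK m0.
by rewrite (bigD1 k) //= ffunE expr0n (negPf mk) mul0r mulr0.
Qed.

Lemma pvalue_const (p : {mpoly F[#|I|]}) (u u' : {ffun I -> F}) :
  p \is 0.-homog -> pvalue p u = pvalue p u'.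
Proof.
move=> /dhomogP p_homog; rewrite /pvalue !mevalE; apply: eq_big_seq => m /p_homog /= /eqP.
by rewrite mdeg_eq0 => /eqP ->; congr (_ * _); apply: eq_bigr => k _; rewrite mnm0E.
Qed.

(* The generators take the same values at u as at 0, hence so does f. *)
Lemma generated_nullcone D : generated_in_degree_le act D ->
  forall u, in_nullcone act u <-> in_nullcone_le act D u.
Proof.
move=> gen u; split=> [nu d f /andP[d0 _]|nu d f d0 f_homog f_inv]; first exact: nu.
have [k [h [q [hh fE]]]] := gen f f_inv.
rewrite -(pvalue_homog0 f_homog d0) fE /pvalue !comp_mpoly_meval.
apply: meval_eq => j; have [h_inv [e eD h_homog]] := hh j.
case: e eD h_homog => [|e] eD h_homog; first exact: pvalue_const.
by rewrite [RHS](pvalue_homog0 h_homog) //; apply: (nu e.+1).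
Qed.

Lemma sigma_le_beta : (sigma act <= beta act)%E.
Proof. exact: least_anti generated_nullcone. Qed.

End SigmaBeta.

(** For smaller D the chain tensor is a common zero of the invariants of degrees 1, ..., D outside
    the null cone. *)
Lemma sigma_tensors_ge (F : numClosedFieldType) n : (0 < n)%N ->
  (((4 ^ n - 1)%N%:Z)%:E <= sigma (@tensor_act F 9 (3 * n) (3 * n) (3 * n)))%E.
Proof.
move=> n0; apply: le_least => D PD; rewrite leqNgt; apply/negP => ltD.
apply: (@chain_notin_nullcone F n n0); apply/PD => d f /andP[d0 dD] f_homog f_inv.
apply/eqP; apply: contraTT ltD => fy; rewrite -leqNgt (leq_trans _ dD) //.
exact: (chain_low_degree n0 d0 f_homog f_inv fy).
Qed.

Local Open Scope complex_scope.

Theorem theorem1p7 (R : realType) (n : nat) (hn : (1 <= n)%N) :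
  ((4%:Z ^+ n - 1)%:E
     <= sigma (@tensor_act R[i] 9 (3 * n) (3 * n) (3 * n))
     <= beta (@tensor_act R[i] 9 (3 * n) (3 * n) (3 * n)))%E.
Proof.
rewrite sigma_le_beta andbT.
have -> : 4%:Z ^+ n - 1 = (4 ^ n - 1)%N%:Z by rewrite -subzn ?expn_gt0 // -[(4 ^ n)%N%:Z]natz natrX natz.
exact: sigma_tensors_ge.
Qed.
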